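(* Let $X$ be a nontrivial mm-space of finite diameter. Then, for any $0<\kappa<1$, we have $$\liminf_{n\to\infty}\frac{\operatorname{ObsDiam}(X_1^n;-\kappa)}{\sqrt n}\ge 2\,\Phi^{-1}(\kappa)\sqrt{V_1(X)},$$ where $$\Phi(r):=\int_r^\infty \frac{1}{\sqrt{2\pi}}e^{-\frac{t^2}{2}}\,dt,\qquad V_1(X):=\sup_{x\in X} V(d_X(x,\cdot)),$$ and $V(f):=\int_X\left(f-\int_X f\,d\mu_X\right)^2 d\mu_X$ is the variance of a function $f:X\to\mathbb{R}$.
   Context: An mm-space is a space $X$ equipped with a complete separable metric $d_X$ and a Borel probability measure $\mu_X$ on $X$. It is nontrivial if $\mu_X$ is not a Dirac measure, i.e. the support of $\mu_X$ has at least two points. $l_1$-product: for $n\ge 1$, $X_1^n := (X^n, d_{X_1^n}, \mu_X^{\otimes n})$, where $d_{X_1^n}(x,y) := \sum_{i=1}^n d_X(x_i,y_i)$ for $x=(x_1,\dots,x_n), y=(y_1,\dots,y_n)\in X^n$ and $\mu_X^{\otimes n}$ is the product measure. Partial diameter: for an mm-space $X$ and a real number $\alpha$, $\operatorname{diam}(X;\alpha)=\operatorname{diam}(\mu_X;\alpha)$ is the infimum of $\operatorname{diam}(A)$ over all Borel subsets $A\subset X$ with $\mu_X(A)\ge \alpha$. Observable diameter: for $\kappa>0$, $\operatorname{ObsDiam}(X;-\kappa)$ is the supremum of $\operatorname{diam}(f_*\mu_X;1-\kappa)$ over all $1$-Lipschitz functions $f:X\to\mathbb{R}$, where $f_*\mu_X$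 is the push-forward measure on $\mathbb{R}$ (with its usual metric). $\Phi^{-1}:(0,1)\to\mathbb{R}$ denotes the inverse function of the strictly decreasing bijection $\Phi:\mathbb{R}\to(0,1)$ (it is negative on $(1/2,1)$). *)

(* Defs.v *)
From HB Require Import structures.
From mathcomp Require Import all_boot all_order all_algebra.
From mathcomp Require Import all_classical all_reals all_analysis.

Set Implicit Arguments.
Unset Strict Implicit.
Unset Printing Implicit Defensive.

Import Order.TTheory GRing.Theory Num.Theory.
Import numFieldNormedType.Exports.
Import numFieldTopology.Exports.

Local Open Scope classical_set_scope.
Local Open Scope ring_scope.

(* [Complete] carries a distinguished point; this costs nothing below, since a
   space bearing a probability measure is nonempty. *)
#[short(type="completeMetricType")]
HB.structure Definition CompleteMetric (K : numDomainType) :=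
  {M of Complete M & Metric K M}.

Notation borelType T := (g_sigma_algebraType (@open T)).

Record mmspace (R : realType) := MMSpace {
  mm_sort :> completeMetricType R ;
  mm_separable : exists2 D : set mm_sort, countable D & dense D ;
  mm_prob : probability (borelType mm_sort) R }.

Section tuple_power.
Context d (T : measurableType d) (R : realType) (P : probability T R).

Definition tuple_cons n (x : T * n.-tuple T) : n.+1.-tuple T :=
  [tuple of x.1 :: x.2].

Lemma measurable_tuple_cons n :
  measurable_fun [set: T * n.-tuple T] (@tuple_cons n).
Proof. exact: (measurable_cons measurable_fst measurable_snd). Qed.

HB.instance Definition _ n := isMeasurableFun.Build _ _ _ _ (@tuple_cons n)
  (@measurable_tuple_cons n).

Fixpoint tuple_power n : probability (n.-tuple T) R :=
  if n is m.+1 then distribution (P \x tuple_power m)%E (@tuple_cons m)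
  else dirac [tuple].

Lemma tuple_powerE n (A : 'I_n -> set T) : (forall i, measurable (A i)) ->
  tuple_power n [set x | forall i, A i (tnth x i)] = (\prod_(i < n) P (A i))%E.
Proof.
elim: n A => [|n IHn] A mA /=.
  by rewrite big_ord0 diracE mem_set//= => -[].
rewrite big_ord_recl /distribution /pushforward.
have mB :
    measurable [set x : n.-tuple T | forall i, A (lift ord0 i) (tnth x i)].
  rewrite (_ : [set _ | _] = \bigcap_(i in [set: 'I_n])
     (fun x : n.-tuple T => tnth x i) @^-1` A (lift ord0 i)); last first.
    by apply/seteqP; split=> [x h i _|x h i]; [exact: h|exact: h i Logic.I].
  apply: fin_bigcap_measurable => // i _.
  by rewrite -[X in measurable X]setTI; apply: measurable_tnth.
rewrite (_ : _ @^-1` _ =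
    A ord0 `*` [set x | forall i, A (lift ord0 i) (tnth x i)]).
  rewrite product_measure1E//; congr (_ * _)%E.
  exact: (IHn (fun i => A (lift ord0 i))).
apply/seteqP; split=> [[x s] h|[x s] [/= h0 h] i].
  split=> [|i]/=; first by have := h ord0; rewrite tnth0.
  by have := h (lift ord0 i); rewrite tnthS.
by case: (unliftP ord0 i) => [j|] ->; rewrite ?tnthS ?tnth0.
Qed.

End tuple_power.

(* An alias, so that the l1 distance is not attached to bare tuples. *)
Definition l1_tuple (T : Type) (n : nat) := n.-tuple T.
HB.instance Definition _ (T : pointedType) n := Pointed.on (l1_tuple T n).

Section l1_metric.
Context (R : realType) (T : completeMetricType R) (n : nat).
Implicit Types x y : l1_tuple T n.

Definition l1_dist x y : R := \sum_(i < n) mdist (tnth x i) (tnth y i).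

Lemma l1_distxx x : l1_dist x x = 0.
Proof. by rewrite /l1_dist big1// => i _; rewrite mdistxx. Qed.

Lemma l1_dist_positivity x y : l1_dist x y = 0 -> x = y.
Proof.
move=> /eqP; rewrite psumr_eq0; last by move=> i _; exact: mdist_ge0.
move=> /allP h; apply: eq_from_tnth => i.
by have /(_ (mem_index_enum _)) /eqP/mdist_positivity := h i.
Qed.

Lemma l1_dist_sym x y : l1_dist x y = l1_dist y x.
Proof. by apply: eq_bigr => i _; exact: metric_sym. Qed.

Lemma l1_dist_triangle y x z : l1_dist x z <= l1_dist x y + l1_dist y z.
Proof.
by rewrite -big_split/=; apply: ler_sum => i _; exact: metric_triangle.
Qed.

HB.instance Definition _ := isMetric.Build R (l1_tuple T n)
  l1_distxx l1_dist_positivity l1_dist_sym l1_dist_triangle.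

Lemma ball_tnth x y (e : R) (i : 'I_n) :
  ball x e y -> ball (tnth x i) e (tnth y i).
Proof.
rewrite !ballEmdist /= => h; apply: le_lt_trans h.
rewrite [leRHS](bigD1 i)//= lerDl; apply: sumr_ge0 => j _.
exact: mdist_ge0.
Qed.

Lemma tnth_ball x y (e : R) : 0 < e ->
  (forall i, ball (tnth x i) (e / n.+1%:R) (tnth y i)) -> ball x e y.
Proof.
move=> e0 h; rewrite ballEmdist /=.
apply: (@le_lt_trans _ _ (\sum_(i < n) e / n.+1%:R)).
  by apply: ler_sum => i _; have := h i; rewrite ballEmdist /= => /ltW.
rewrite sumr_const card_ord -mulrnAr -mulr_natr mulrA -[ltRHS]mulr1 -mulrA.
by rewrite ltr_pM2l// mulrC ltr_pdivrMr// mul1r ltr_nat.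
Qed.

Lemma l1_cauchy_cvg (F : set_system (l1_tuple T n)) :
  ProperFilter F -> cauchy F -> cvg F.
Proof.
move=> FF /cauchy_ballP Fc.
pose G i := (fun x : l1_tuple T n => tnth x i) @ F.
have Gc i : cvg (G i).
  apply: cauchy_cvg; apply/cauchy_ballP => e e0; rewrite near_map2.
  by apply: filterS (Fc _ e0) => -[x y] /= /(ball_tnth i).
apply/cvg_ex; exists [tuple lim (G i) | i < n] => /=.
apply/fcvg_ballP => e e0.
have en0 : 0 < e / n.+1%:R by rewrite divr_gt0.
have h : \forall x \near F, forall i,
    ball (lim (G i)) (e / n.+1%:R) (tnth x i).
  by apply: filter_forall => i; exact: (cvg_ballP _ _).1 (Gc i) _ en0.
apply: filterS h => x h; apply: tnth_ball => // i.
by rewrite tnth_mktuple.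
Qed.

HB.instance Definition _ := Uniform_isComplete.Build (l1_tuple T n)
  l1_cauchy_cvg.

End l1_metric.

Section l1_separable.
Context (R : realType) (T : completeMetricType R) (n : nat) (D : set T).
Hypotheses (cD : countable D) (dD : dense D).

Let Dn : set (l1_tuple T n) := [set x | forall i, D (tnth x i)].

Lemma open_mball (x : T) (e : R) : open (ball x e).
Proof.
rewrite openE => y; rewrite ballEmdist /= => xy; apply/nbhs_ballP.
exists (e - mdist x y) => /=; first by rewrite subr_gt0.
move=> z; rewrite !ballEmdist /= ltrBrDl => yz.
exact: le_lt_trans (metric_triangle _ _ _) yz.
Qed.

Lemma dense_ball (x : T) (e : R) : 0 < e -> exists2 y, D y & ball x e y.
Proof.
move=> e0; have [||y [/interior_subset ? ?]] := dD (O := (ball x e)°).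
- by exists x; exact: nbhsx_ballx.
- exact: open_interior.
- by exists y.
Qed.

Lemma countable_l1 : countable Dn.
Proof.
have /countable_injP[f finj] := cD.
apply/countable_injP; exists (fun x => pickle [seq f y | y <- val x]).
move=> x y; rewrite !inE => Dx Dy /(pcan_inj pickleK) xy.
apply: eq_from_tnth => i; apply: finj; rewrite ?inE//.
have := congr1 (fun s => nth 0 s i) xy.
by rewrite !(nth_map (tnth x i)) ?size_tuple// -!tnth_nth.
Qed.

Lemma l1_approx (x : l1_tuple T n) (e : R) : 0 < e ->
  exists2 y, Dn y & forall i, ball (tnth x i) e (tnth y i).
Proof.
move=> e0; have h i := cid2 (dense_ball (tnth x i) e0).
exists [tuple s2val (h i) | i < n] => i /=; rewrite tnth_mktuple.
  exact: s2valP (h i).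
exact: s2valP' (h i).
Qed.

Lemma dense_l1 : dense Dn.
Proof.
move=> O [x Ox] oO; have /nbhs_ballP[e /= e0 eO] : nbhs x O.
  exact: open_nbhs_nbhs.
have [|y Dy xy] := @l1_approx x (e / n.+1%:R); first by rewrite divr_gt0.
by exists y; split => //; apply: eO; exact: tnth_ball.
Qed.

Lemma measurable_open_l1 (O : set (l1_tuple T n)) : open O ->
  measurable (O : set (n.-tuple (borelType T))).
Proof.
move=> oO.
pose box (p : l1_tuple T n * nat) : set (l1_tuple T n) :=
  [set y | forall i, ball (tnth p.1 i) p.2.+1%:R^-1 (tnth y i)].
pose I := [set p | Dn p.1 /\ box p `<=` O].
have -> : O = \bigcup_(p in I) box p.
  apply/seteqP; split=> [x Ox|x [p [_ +]]]; last by apply.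
  have /nbhs_ballP[e /= e0 eO] : nbhs x O by exact: open_nbhs_nbhs.
  have : 0 < e / n.+1%:R / 2 by rewrite !divr_gt0.
  move=> /ltr_add_invr[k]; rewrite add0r => ke.
  have [|y Dy xy] := @l1_approx x k.+1%:R^-1; first by rewrite invr_gt0.
  exists (y, k); last by move=> i; exact/ball_sym/xy.
  split=> // z yz; apply: eO; apply: tnth_ball => // i.
  apply: (@le_ball _ _ _ (k.+1%:R^-1 + k.+1%:R^-1)).
    by rewrite [leRHS]splitr lerD// ltW.
  exact: ball_triangle (xy i) (yz i).
have /countable_injP[f finj] : countable (Dn `*` [set: nat]).
  by apply: countableX; [exact: countable_l1|exact: countableP].
have -> : \bigcup_(p in I) box p =
    \bigcup_k \bigcup_(p in I `&` f @^-1` [set k]) box p.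
  apply/seteqP; split=> [x [p Ip px]|x [k _ [p [Ip _] px]]].
    by exists (f p) => //; exists p.
  by exists p.
apply: bigcup_measurable => k _.
have [[p [Ip fp]]|pN] := pselect (I `&` f @^-1` [set k] !=set0); last first.
  rewrite (_ : \bigcup_(_ in _) _ = set0); first exact: measurable0.
  by rewrite -subset0 => x [p Ip _]; apply: pN; exists p.
rewrite (_ : I `&` _ = [set p]); last first.
  apply/seteqP; split=> [q [[Dq _] fq]|_ ->//].
  by apply: finj; rewrite ?inE; [split| case: Ip |rewrite fq fp].
rewrite bigcup_set1 (_ : box p = \bigcap_(i in [set: 'I_n])
   (fun x : n.-tuple (borelType T) => tnth x i) @^-1`
     [set y | ball (tnth p.1 i) p.2.+1%:R^-1 y]); last first.
  by apply/seteqP; split=> [x h i _|x h i]; [exact: h|exact: h i Logic.I].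
apply: fin_bigcap_measurable => // i _.
rewrite -[X in measurable X]setTI; apply: measurable_tnth => //.
apply: sub_sigma_algebra => /=.
exact: open_mball.
Qed.

End l1_separable.

Section l1_prob.
Context (R : realType) (X : mmspace R) (n : nat).

(* [n.-tuple] carries the product sigma-algebra while an mm-space needs the
   Borel one of its metric.  By separability open sets are product measurable,
   so the product measure transports along the identity. *)
Definition l1_borel (x : n.-tuple (borelType X)) :
  borelType (l1_tuple X n) := x.

Lemma measurable_l1_borel :
  measurable_fun [set: n.-tuple (borelType X)] l1_borel.
Proof.
have [D cD dD] := mm_separable X.
pose G : set (set (borelType (l1_tuple X n))) := @open (l1_tuple X n).
apply: (@measurability _ _ _ _ setT l1_borel G) => // _ [U oU <-].
by rewrite setTI; exact: (measurable_open_l1 cD dD).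
Qed.

HB.instance Definition _ := isMeasurableFun.Build _ _ _ _ l1_borel
  measurable_l1_borel.

Lemma l1_separable :
  exists2 D : set (l1_tuple X n), countable D & dense D.
Proof.
have [D cD dD] := mm_separable X.
exists [set x | forall i, D (tnth x i)]; first exact: countable_l1.
exact: dense_l1.
Qed.

Definition l1_product : mmspace R :=
  MMSpace l1_separable (distribution (tuple_power (mm_prob X) n) l1_borel).

End l1_prob.

Section observable_diameter.
Context (R : realType).
Local Open Scope ereal_scope.

(* The point 0 only serves to give the empty set diameter 0 rather than -oo. *)
Definition diam (T : metricType R) (A : set T) : \bar R :=
  ereal_sup (0 |` [set (mdist p.1 p.2)%:E | p in A `*` A]).

Definition partial_diam (T : metricType R) (mu : set T -> \bar R) (alpha : R)
    : \bar R :=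
  ereal_inf [set diam A | A in [set A | <<s @open T >> A /\ alpha%:E <= mu A]].

Definition lipschitz1 (X : metricType R) (f : X -> R) : Prop :=
  forall x y, (`|f x - f y| <= mdist x y)%R.

(* [R^o] is the real line with the metric |y - x|; [pushforward mu f] maps A to
   mu (f @^-1` A). *)
Definition obs_diam (X : mmspace R) (kappa : R) : \bar R :=
  ereal_sup [set @partial_diam R^o
                   (@pushforward _ _ (borelType X) (borelType R^o) R
                      (mm_prob X) f)
                   (1 - kappa)
            | f in [set f : X -> R^o | lipschitz1 f]].

(* Equality with a Dirac measure is only meaningful on Borel sets. *)
Definition nontrivial (X : mmspace R) : Prop :=
  ~ exists x : borelType X, forall A : set (borelType X),
      measurable A -> mm_prob X A = \d_x A.

Definition V1 (X : mmspace R) : \bar R :=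
  ereal_sup [set 'V_(mm_prob X)[mdist x] | x in [set: X]].

End observable_diameter.

Definition Phi (R : realType) (r : R) : R :=
  \int[lebesgue_measure]_(t in `[r, +oo[)
    ((Num.sqrt (2 * pi))^-1 * expR (- (t ^+ 2 / 2))).

Definition Phi_inv (R : realType) : R -> R := pinv [set: R] (@Phi R).

(* Main.v *)
(* If X has finite diameter, the function y |-> sum_i d(x, y_i) is
   1-Lipschitz for the l1 distance, and under the product measure it is a sum of
   n bounded i.i.d. variables of variance V = V(d(x, .)).  By the central
   limit theorem, for every t < Phi^{-1}(kappa) and n large, it deviates from
   its mean by at least t sqrt(nV) upwards, and also downwards, with
   probability more than kappa.  A set of measure at least 1 - kappa meets
   both tails, hence has diameter at least 2 t sqrt(nV).

   The central limit theorem is proved by Lindeberg's replacement method, for test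
   functions having a second order expansion with cubic remainder at every point,
   a property stable under averaging.  The moments of the normal law come from
   1 + z <= e^z, integrated against shifted and rescaled normal densities, and
   its stability under convolution from completing the square. *)

Require Import Defs.
From mathcomp Require Import all_boot all_order all_algebra.
From mathcomp Require Import all_classical all_reals all_analysis.
From mathcomp Require Import measurable_realfun ring lra.

Set Implicit Arguments.
Unset Strict Implicit.
Unset Printing Implicit Defensive.

Import Order.TTheory GRing.Theory Num.Theory.
Import numFieldNormedType.Exports.

Local Open Scope classical_set_scope.
Local Open Scope ring_scope.

(** * Convolution of normal laws *)

Section normal.
Context {R : realType}.
Local Notation mu := (@lebesgue_measure R).
Implicit Types (m s t c h : R) (f : R -> \bar R).

(** The Radon-Nikodym derivative with respect to Lebesgue measure and the explicit density have the
    same integral over every measurable set, hence agree almost everywhere. *)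
Lemma integral_normal_prob m s f : measurable_fun [set: R] f ->
  (forall x, 0 <= f x)%E ->
  (\int[normal_prob m s]_x f x = \int[mu]_x (f x * (normal_pdf m s x)%:E))%E.
Proof.
move=> mf f0; pose RN := Radon_Nikodym_SigmaFinite.f (normal_prob m s) mu.
have dom := normal_prob_dominates m s.
rewrite -(Radon_Nikodym_SigmaFinite.change_of_variables dom f0 measurableT mf).
have iRN : mu.-integrable setT RN by exact: Radon_Nikodym_SigmaFinite.f_integrable.
apply: ae_eq_integral => //.
- by apply: emeasurable_funM => //; exact: measurable_int iRN.
- by apply: emeasurable_funM => //; apply/measurable_EFinP; exact: measurable_normal_pdf.
suff : ae_eq mu setT RN (fun x => (normal_pdf m s x)%:E).
  by apply: filterS => x RNx _; congr (_ * _)%E; exact: RNx.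
apply: integral_ae_eq => //.
- by apply/measurable_EFinP; exact: measurable_normal_pdf.
- by move=> A _ mA; rewrite -Radon_Nikodym_SigmaFinite.f_integral.
Qed.

Lemma normal_peakM s c : 0 < c -> normal_peak (c * s) = normal_peak s / c.
Proof.
move=> c0; rewrite /normal_peak exprMn -mulrA -mulrnAr sqrtrM ?sqr_ge0//.
by rewrite sqrtr_sqr gtr0_norm// invfM mulrC.
Qed.

(** The exponential is the likelihood ratio of the two laws: its exponent is the difference of the
    two quadratic exponents. *)
Lemma normal_pdf_shift m s h x : 0 < s ->
  expR (h * (x - m) / s ^+ 2 - h ^+ 2 / (2 * s ^+ 2)) * normal_pdf m s x =
  normal_pdf (m + h) s x.
Proof.
move=> s0; have sn : s != 0 by rewrite gt_eqF.
rewrite !normal_pdfE// /normal_fun mulrCA -expRD; congr (_ * expR _).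
by rewrite -[s ^+ 2 *+ 2]mulr_natr; field.
Qed.

(** Again a likelihood ratio, now between deviations; the factor [c] makes up for the lower peak of
    the wider density. *)
Lemma normal_pdf_scale m s c x : 0 < s -> 0 < c ->
  expR ((1 - c ^- 2) * (x - m) ^+ 2 / (2 * s ^+ 2)) * normal_pdf m s x =
  c * normal_pdf m (c * s) x.
Proof.
move=> s0 c0; have sn : s != 0 by rewrite gt_eqF.
have cn : c != 0 by rewrite gt_eqF.
rewrite !normal_pdfE ?mulf_neq0// /normal_fun normal_peakM// mulrCA -expRD.
rewrite [RHS]mulrA [c * _]mulrC divfK//; congr (_ * expR _).
by rewrite -[s ^+ 2 *+ 2]mulr_natr -[(c * s) ^+ 2 *+ 2]mulr_natr; field; rewrite sn cn.
Qed.

Lemma integral_normal_expR_lin m s h : 0 < s ->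
  (\int[normal_prob m s]_x
     (expR (h * (x - m) / s ^+ 2 - h ^+ 2 / (2 * s ^+ 2)))%:E = 1)%E.
Proof.
move=> s0; rewrite integral_normal_prob//; last first.
  apply/measurable_EFinP; apply: measurableT_comp => //; apply: measurable_funB => //.
  apply: measurable_funM => //; apply: measurable_funM => //.
  exact: measurable_funB.
under eq_integral do rewrite -EFinM normal_pdf_shift//.
exact: integral_normal_pdf.
Qed.

Lemma integral_normal_expR_sqr m s c : 0 < s -> 0 < c ->
  (\int[normal_prob m s]_x
     (expR ((1 - c ^- 2) * (x - m) ^+ 2 / (2 * s ^+ 2)))%:E = c%:E)%E.
Proof.
move=> s0 c0; rewrite integral_normal_prob//; last first.
  apply/measurable_EFinP; apply: measurableT_comp => //.
  apply: measurable_funM => //; apply: measurable_funM => //.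
  by apply: measurable_funX; exact: measurable_funB.
under eq_integral do rewrite -EFinM normal_pdf_scale// EFinM.
rewrite integralZl//; last exact: integrable_normal_pdf.
by rewrite integral_normal_pdf mule1.
Qed.

(** Completing the square in [y]: the joint density of a normal start [y] and endpoint [w] is the
    density of the endpoint times that of the start given the endpoint. *)
Lemma normal_pdfM m s t y w : 0 < s -> 0 < t ->
  let r := Num.sqrt (s ^+ 2 + t ^+ 2) in
  normal_pdf m s y * normal_pdf y t w =
  normal_pdf m r w *
    normal_pdf ((m * t ^+ 2 + w * s ^+ 2) / r ^+ 2) (s * t / r) y.
Proof.
move=> s0 t0 r; have r2 : r ^+ 2 = s ^+ 2 + t ^+ 2.
  by rewrite sqr_sqrtr// addr_ge0 ?sqr_ge0.
have r0 : 0 < r by rewrite sqrtr_gt0 addr_gt0 ?exprn_gt0.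
have [sn tn rn] : [/\ s != 0, t != 0 & r != 0] by rewrite !gt_eqF.
have an : s ^+ 2 + t ^+ 2 != 0 by rewrite -r2 expf_neq0.
rewrite !normal_pdfE ?mulf_neq0 ?invr_eq0// /normal_fun.
rewrite mulrACA -expRD [RHS]mulrACA -expRD; congr (_ * expR _).
  (* Expressing all four peaks through [normal_peak 1] turns the identity of constants into a
     rational one. *)
  have pE c : 0 < c -> normal_peak c = normal_peak 1 / c :> R.
    by move=> c0; rewrite -normal_peakM// mulr1.
  rewrite (pE s)// (pE t)// (pE r)// (pE (s * t / r)) ?divr_gt0 ?mulr_gt0//.
  by field; rewrite rn sn tn.
rewrite -[s ^+ 2 *+ 2]mulr_natr -[t ^+ 2 *+ 2]mulr_natr -[r ^+ 2 *+ 2]mulr_natr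
  -[(s * t / r) ^+ 2 *+ 2]mulr_natr !exprMn !exprVn !r2.
by field; rewrite sn tn an.
Qed.

Lemma measurable_normal_pdf2 t : 0 < t ->
  measurable_fun setT (fun z : R * R => normal_pdf z.1 t z.2).
Proof.
move=> t0; rewrite (_ : (fun _ => _) = (fun z => normal_peak t *
    expR (- (z.2 - z.1) ^+ 2 / (t ^+ 2 *+ 2)))); last first.
  by apply/funext => z; rewrite normal_pdfE// gt_eqF.
apply: measurable_funM => //; apply: measurableT_comp => //.
apply: measurable_funM => //; apply: measurableT_comp => //.
by apply: measurable_funX; exact: measurable_funB.
Qed.

(** After exchanging the integrals by Tonelli, [normal_pdfM] isolates a normal density in [y], which
    integrates to 1. *)
Lemma integral_normal_convolution m s t f : 0 < s -> 0 < t ->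
  measurable_fun [set: R] f -> (forall x, 0 <= f x)%E ->
  (\int[normal_prob m s]_y \int[normal_prob y t]_w f w =
   \int[normal_prob m (Num.sqrt (s ^+ 2 + t ^+ 2))]_w f w)%E.
Proof.
move=> s0 t0 mf f0.
have r0 : 0 < Num.sqrt (s ^+ 2 + t ^+ 2) by rewrite sqrtr_gt0 addr_gt0 ?exprn_gt0.
pose F (z : R * R) := (f z.2 * (normal_pdf z.1 t z.2)%:E)%E.
have mF : measurable_fun setT F.
  apply: emeasurable_funM; first exact: measurableT_comp.
  by apply/measurable_EFinP; exact: measurable_normal_pdf2.
have F0 z : (0 <= F z)%E by rewrite mule_ge0// lee_fin normal_pdf_ge0.
pose H (z : R * R) := ((normal_pdf m s z.1)%:E * F z)%E.
have mH : measurable_fun setT H.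
  apply: emeasurable_funM => //; apply/measurable_EFinP.
  by apply: measurableT_comp => //; exact: measurable_normal_pdf.
have H0 z : (0 <= H z)%E by rewrite mule_ge0// lee_fin normal_pdf_ge0.
under eq_integral do rewrite integral_normal_prob//.
rewrite [LHS]integral_normal_prob//; last 2 first.
- exact: (@measurable_fun_fubini_tonelli_F _ _ _ _ R mu F mF F0).
- by move=> y; apply: integral_ge0 => w _; exact: (F0 (y, w)).
transitivity (\int[mu]_y \int[mu]_w H (y, w))%E.
  apply: eq_integral => y _; rewrite muleC -ge0_integralZl//.
  - apply: emeasurable_funM => //; apply/measurable_EFinP.
    exact: measurable_normal_pdf.
  - by move=> w _; exact: (F0 (y, w)).
  - by rewrite lee_fin normal_pdf_ge0.
rewrite (@fubini_tonelli _ _ _ _ R mu mu H mH H0) integral_normal_prob//.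
apply: eq_integral => w _; rewrite /H /F/=.
under eq_integral do rewrite muleCA -EFinM normal_pdfM// EFinM muleA.
rewrite ge0_integralZl//.
- by rewrite integral_normal_pdf mule1.
- by apply/measurable_EFinP; exact: measurable_normal_pdf.
- by move=> y _; rewrite lee_fin normal_pdf_ge0.
- by rewrite mule_ge0// lee_fin normal_pdf_ge0.
Qed.

End normal.

(** * Moments of the normal law *)

Lemma expr_le1D (R : realType) (y : R) (n k : nat) : 0 <= y -> (n <= k)%N ->
  y ^+ n <= 1 + y ^+ k.
Proof.
move=> y0 nk; have [y1|/ltW y1] := leP y 1.
  by rewrite (le_trans (exprn_ile1 n y0 y1))// lerDl exprn_ge0.
by rewrite (le_trans (ler_weXn2l y1 nk))// lerDr.
Qed.

(** * Integrability and real-valued integrals under a probability measure *)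

Section rintegral.
Context d (T : measurableType d) (R : realType) (P : probability T R).

Lemma bounded_integrable (f : T -> R) (M : R) :
  measurable_fun setT f -> (forall x, `|f x| <= M) ->
  P.-integrable setT (EFin \o f).
Proof.
move=> mf fM; apply: measurable_bounded_integrable => //.
  exact: le_lt_trans (probability_le1 P measurableT) (ltry 1).
exists M; split => [|y My t _]; first exact: num_real.
exact: le_trans (fM t) (ltW My).
Qed.

Lemma ge0_integrable (f : T -> R) : measurable_fun setT f ->
  (forall x, 0 <= f x) -> (\int[P]_x (f x)%:E < +oo)%E ->
  P.-integrable setT (EFin \o f).
Proof.
move=> mf f0 foo; apply/integrableP; split; first exact/measurable_EFinP.
by under eq_integral do rewrite gee0_abs ?lee_fin//.
Qed.

Lemma Rintegral_cst1 (r : R) : \int[P]_x r = r.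
Proof.
rewrite Rintegral_cst// -[RHS]mulr1; congr (_ * _).
exact: (congr1 fine (probability_setT P)).
Qed.

Lemma le_integrable_fin (f g : T -> R) : measurable_fun setT f ->
  (forall x, `|f x| <= g x) -> P.-integrable setT (EFin \o g) ->
  P.-integrable setT (EFin \o f).
Proof.
move=> mf fg; apply: le_integrable => //; first exact/measurable_EFinP.
by move=> x _; rewrite lee_fin (le_trans (fg x))// ler_norm.
Qed.

Lemma integrable_cst1 (r : R) : P.-integrable setT (EFin \o cst r).
Proof. exact: (@bounded_integrable _ `|r|). Qed.

Lemma integrable_scale (k : R) (f : T -> R) :
  P.-integrable setT (EFin \o f) ->
  P.-integrable setT (EFin \o (fun x => k * f x)).
Proof. exact: integrableZl. Qed.

Lemma integrable_add (f g : T -> R) : P.-integrable setT (EFin \o f) ->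
  P.-integrable setT (EFin \o g) ->
  P.-integrable setT (EFin \o (fun x => f x + g x)).
Proof. exact: integrableD. Qed.

Lemma integrable_expr (f : T -> R) (n k : nat) : measurable_fun setT f ->
  (n <= k)%N -> P.-integrable setT (EFin \o (fun x => `|f x| ^+ k)) ->
  P.-integrable setT (EFin \o (fun x => f x ^+ n)).
Proof.
move=> mf nk fk; apply: (@le_integrable_fin _ (fun x => 1 + `|f x| ^+ k)).
- exact: measurable_funX.
- by move=> x; rewrite normrX expr_le1D.
- exact: integrable_add (integrable_cst1 1) fk.
Qed.

Lemma integrable_indicator (A : set T) : measurable A ->
  P.-integrable setT (EFin \o (\1_A : T -> R)).
Proof.
move=> mA; apply: (@bounded_integrable _ 1); first exact: measurable_indic.
by move=> x; rewrite indicE ger0_norm//; case: (x \in A).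
Qed.

Lemma Rintegral_indicator (A : set T) : measurable A ->
  (\int[P]_x (\1_A x : R))%:E = P A.
Proof.
move=> mA; rewrite /Rintegral fineK; first by rewrite integral_indic// setIT.
by apply: integrable_fin_num => //; exact: integrable_indicator.
Qed.

End rintegral.

Section normal_moments.
Context {R : realType}.
Variables (m s : R).
Hypothesis s0 : 0 < s.
Local Notation N := (normal_prob m s).

Let mY : measurable_fun setT (fun x : R => x - m).
Proof. exact: measurable_funB. Qed.

Let lin h (x : R) := expR (h * (x - m) / s ^+ 2 - h ^+ 2 / (2 * s ^+ 2)).
Let sqr c (x : R) := expR ((1 - c ^- 2) * (x - m) ^+ 2 / (2 * s ^+ 2)).

Let ilin h : N.-integrable setT (EFin \o lin h).
Proof.
apply: ge0_integrable.
- apply: measurableT_comp => //; apply: measurable_funB => //.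
  by apply: measurable_funM => //; exact: measurable_funM.
- by move=> x; exact: expR_ge0.
- by rewrite integral_normal_expR_lin// ltry.
Qed.

Let isqr c : 0 < c -> N.-integrable setT (EFin \o sqr c).
Proof.
move=> c0; apply: ge0_integrable.
- apply: measurableT_comp => //; apply: measurable_funM => //.
  by apply: measurable_funM => //; exact: measurable_funX.
- by move=> x; exact: expR_ge0.
- by rewrite integral_normal_expR_sqr// ltry.
Qed.

Let Isqr c : 0 < c -> \int[N]_x (sqr c x) = c.
Proof. by move=> c0; rewrite /Rintegral integral_normal_expR_sqr. Qed.

(** In terms of [z], [sqr 2] is exp (3/8 z^2), which is at least 1 + 9/128 z^4. As 15 times 9/128
    exceeds 1, it absorbs the z^4 of z^3 <= 1 + z^4. *)
Let le_cube x : `|x - m| ^+ 3 <= s ^+ 3 * (1 + 15 * sqr 2 x).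
Proof.
set z := `|x - m| / s.
have z0 : 0 <= z by rewrite divr_ge0// ltW.
have -> : `|x - m| = s * z by rewrite /z mulrC divfK// gt_eqF.
rewrite exprMn ler_pM2l ?exprn_gt0//.
have qE : (1 - 2 ^- 2) * (x - m) ^+ 2 / (2 * s ^+ 2) = 3 / 8 * z ^+ 2 :> R.
  by rewrite /z expr_div_n real_normK ?num_real//; field; rewrite gt_eqF.
have : 1 + (3 / 8 * z ^+ 2) ^+ 2 / 2`!%:R <= sqr 2 x.
  by rewrite /sqr qE; apply: expR_ge1Dxn => //; rewrite mulr_ge0// exprn_ge0.
rewrite /= => h.
have : z ^+ 3 <= 1 + z ^+ 4 by exact: expr_le1D.
have := exprn_ge0 4 z0.
move: h; rewrite (_ : 2`! = 2)// exprMn -exprM.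
move: (z ^+ (2 * 2)) (z ^+ 3) (sqr 2 x) => z4 z3 e; lra.
Qed.

Lemma integrable_normal_cube :
  N.-integrable setT (EFin \o (fun x => `|x - m| ^+ 3)).
Proof.
apply: (@le_integrable_fin _ _ _ N _ (fun x => s ^+ 3 * (1 + 15 * sqr 2 x))).
- by apply: measurable_funX; exact: measurableT_comp.
- by move=> x; rewrite ger0_norm ?exprn_ge0.
- apply: (@integrable_scale _ _ _ N); apply: (@integrable_add _ _ _ N).
    exact: (integrable_cst1 N 1).
  by apply: (@integrable_scale _ _ _ N); exact: isqr.
Qed.

(** The constant is 1 + 15 * 2, where 2 is the integral of [sqr 2]; only its independence of [s]
    matters later. *)
Lemma normal_cube_le : \int[N]_x (`|x - m| ^+ 3) <= 31 * s ^+ 3.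
Proof.
have i15 : N.-integrable setT (EFin \o (fun x => 15 * sqr 2 x)).
  by apply: (@integrable_scale _ _ _ N); exact: isqr.
have i1 := integrable_cst1 N 1.
have iD : N.-integrable setT (EFin \o (fun x => 1 + 15 * sqr 2 x)).
  exact: (integrable_add i1 i15).
apply: (@le_trans _ _ (\int[N]_x (s ^+ 3 * (1 + 15 * sqr 2 x)))).
  apply: le_Rintegral => //; first exact: integrable_normal_cube.
  exact: (@integrable_scale _ _ _ N).
rewrite RintegralZl// RintegralD// Rintegral_cst1 RintegralZl//; last exact: isqr.
by rewrite Isqr// mulrC ler_pM2r ?exprn_gt0//; lra.
Qed.

Lemma integrable_normal_center : N.-integrable setT (EFin \o (fun x => x - m)).
Proof.
apply: (@integrable_expr _ _ _ N (fun x => x - m) 1 3) => //.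
exact: integrable_normal_cube.
Qed.

Lemma integrable_normal_sqr :
  N.-integrable setT (EFin \o (fun x => (x - m) ^+ 2)).
Proof.
apply: (@integrable_expr _ _ _ N (fun x => x - m) 2 3) => //.
exact: integrable_normal_cube.
Qed.

(* Integrating [1 + z <= expR z] against the shifted densities gives
   [h * M <= h ^ 2 / 2] for every [h], where [M] is the integral below. *)
Lemma normal_mean : \int[N]_x (x - m) = 0.
Proof.
set M := Rintegral _ _ _.
have key h : h * M <= h ^+ 2 / 2.
  have : \int[N]_x (1 + (h / s ^+ 2 * (x - m) - h ^+ 2 / (2 * s ^+ 2))) <= 1.
    rewrite -[leRHS](_ : \int[N]_x (lin h x) = 1); last first.
      by rewrite /Rintegral integral_normal_expR_lin.
    apply: le_Rintegral => //; last first.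
      by move=> x _; rewrite (le_trans _ (expR_ge1Dx _))// (mulrAC h).
    apply: (@integrable_add _ _ _ N); first exact: (integrable_cst1 N 1).
    apply: (@integrable_add _ _ _ N).
      apply: (@integrable_scale _ _ _ N); exact: integrable_normal_center.
    exact: (integrable_cst1 N (- (h ^+ 2 / (2 * s ^+ 2)))).
  under eq_Rintegral do rewrite addrCA.
  rewrite RintegralD//; last 2 first.
  - apply: (@integrable_scale _ _ _ N); exact: integrable_normal_center.
  - exact: (integrable_cst1 N (1 - h ^+ 2 / (2 * s ^+ 2))).
  rewrite RintegralZl// ?Rintegral_cst1; last exact: integrable_normal_center.
  rewrite -/M => H.
  have : h * M / s ^+ 2 <= (h ^+ 2 / 2) / s ^+ 2.
    have -> : h ^+ 2 / 2 / s ^+ 2 = h ^+ 2 / (2 * s ^+ 2) by field; rewrite gt_eqF.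
    by rewrite mulrAC; lra.
  by rewrite ler_pM2r// invr_gt0 exprn_gt0.
(* The choice [h = M] yields M^2 <= M^2 / 2. *)
have := key M; rewrite -expr2 => h.
by apply/eqP; rewrite -sqrf_eq0 eq_le sqr_ge0 andbT; lra.
Qed.

(* Integrating [1 + z <= expR z] against the densities rescaled by [c], and
   letting [c] tend to 1 from both sides. *)
Lemma normal_variance : \int[N]_x ((x - m) ^+ 2) = s ^+ 2.
Proof.
set V := Rintegral _ _ _; pose v := V / s ^+ 2.
have key c : 0 < c -> 1 + (1 - c ^- 2) * v / 2 <= c.
  move=> c0; rewrite -[leRHS](Isqr c0).
  have -> : 1 + (1 - c ^- 2) * v / 2 =
      \int[N]_x (1 + (1 - c ^- 2) / (2 * s ^+ 2) * (x - m) ^+ 2).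
    rewrite RintegralD//; last 2 first.
    - exact: (integrable_cst1 N 1).
    - apply: (@integrable_scale _ _ _ N); exact: integrable_normal_sqr.
    rewrite RintegralZl// ?Rintegral_cst1; last exact: integrable_normal_sqr.
    by rewrite -/V /v; field; rewrite !gt_eqF.
  apply: le_Rintegral => //; last 2 first.
  - exact: isqr.
  - by move=> x _; rewrite (le_trans _ (expR_ge1Dx _))// (mulrAC (1 - _)).
  apply: (@integrable_add _ _ _ N); first exact: (integrable_cst1 N 1).
  apply: (@integrable_scale _ _ _ N); exact: integrable_normal_sqr.
have key2 c : 0 < c -> (c ^+ 2 - 1) * v <= 2 * (c - 1) * c ^+ 2.
  move=> c0; have := key c c0.
  rewrite -(ler_pM2r (exprn_gt0 2 c0) (1 + _)).
  have -> : (1 + (1 - c ^- 2) * v / 2) * c ^+ 2 = c ^+ 2 + (c ^+ 2 - 1) * v / 2.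
    by field; rewrite gt_eqF.
  lra.
(* Dividing [key2] by [c - 1] gives (c + 1) v <= 2 c^2 for [c > 1] and the reverse for [c < 1].
   Taking [c = 1 + e / 2], then [c = 1 - e / 2], bounds [v] within [e] of 1. *)
have v1 : v = 1.
  apply/eqP; rewrite eq_le; apply/andP; split.
    apply/ler_addgt0Pr => e e0.
    have := key2 (1 + e / 2) ltac:(lra).
    have -> : (1 + e / 2) ^+ 2 - 1 = e / 2 * (2 + e / 2) by ring.
    have -> : 2 * (1 + e / 2 - 1) * (1 + e / 2) ^+ 2 =
      e / 2 * (2 * (1 + e / 2) ^+ 2) by ring.
    rewrite -[leLHS]mulrA ler_pM2l ?divr_gt0// => h.
    rewrite -(ler_pM2l (_ : 0 < 2 + e / 2)); last lra.
    by rewrite (le_trans h)//; nra.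
  apply/ler_addgt0Pr => e e0.
  (* The choice [1 - e / 2] has to be positive; for [e >= 1] the bound follows from [0 <= v]. *)
  have [e1|e1] := leP 1 e.
    by rewrite (le_trans e1)// lerDr divr_ge0 ?sqr_ge0//;
       apply: Rintegral_ge0 => x _; exact: sqr_ge0.
  have := key2 (1 - e / 2) ltac:(lra).
  have -> : (1 - e / 2) ^+ 2 - 1 = - (e / 2 * (2 - e / 2)) by ring.
  have -> : 2 * (1 - e / 2 - 1) * (1 - e / 2) ^+ 2 =
    - (e / 2 * (2 * (1 - e / 2) ^+ 2)) by ring.
  rewrite mulNr lerN2 -[leRHS]mulrA ler_pM2l ?divr_gt0// => h.
  rewrite -(ler_pM2l (_ : 0 < 2 - e / 2)); last lra.
  by rewrite mulrDr -lerBlDr (le_trans _ h)//; nra.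
by rewrite -[RHS]mul1r -v1 /v divfK// expf_neq0// gt_eqF.
Qed.

End normal_moments.

(** * Second order expansions *)

(** The numbers [a] and [b] stand for the first two derivatives at [x]. No derivative is mentioned,
    so expectations can be expanded without differentiating under the integral. *)
Definition taylor2 (R : realType) (C : R) (u : R -> R) (x a b : R) :=
  forall h, `|u (x + h) - u x - a * h - b * (h ^+ 2 / 2)| <= C * `|h| ^+ 3.

(** Serves to make averages of a test function measurable in their base point. *)
Lemma taylor2_continuous (R : realType) (C : R) (u : R -> R) :
  (forall x, exists a b, taylor2 C u x a b) -> continuous u.
Proof.
move=> uT x; have [a [b H]] := uT x.
pose B y := C * `|y - x| ^+ 3 + `|a * (y - x) + b * ((y - x) ^+ 2 / 2)|.
have cB : B y @[y --> x] --> (0 : R).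
  have yx : (fun y : R => y - x) @ x --> (0 : R).
    by rewrite -(subrr x); apply: cvgB; [exact: cvg_id|exact: cvg_cst].
  have -> : (0 : R) = C * `|0 : R| ^+ 3 + `|a * 0 + b * (0 ^+ 2 / 2)|.
    by rewrite normr0 !expr0n/= mul0r !mulr0 addr0 normr0 addr0.
  apply: cvgD.
    by apply: cvgMr; exact: (cvg_comp _ _ (cvg_norm yx) (@exprn_continuous R 3 `|0|)).
  apply: cvg_norm; apply: cvgD; first exact: cvgMr.
  by apply: cvgMr; apply: cvgMl; exact: (cvg_comp _ _ yx (@exprn_continuous R 2 0)).
have uB y : `|u y - u x| <= B y.
  have := H (y - x); rewrite (addrC x) subrK => h.
  rewrite /B; set p := a * _ in h *; set q := b * _ in h *.
  rewrite -[u y - u x](subrK (p + q)) (le_trans (ler_normD _ _))// lerD2r.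
  by rewrite opprD addrA.
suff : (fun y => u y - u x) @ x --> (0 : R).
  move=> /(cvgD (cvg_cst (u x))); rewrite addr0.
  by apply: cvg_trans; apply: near_eq_cvg; apply: nearW => y /=; rewrite addrC subrK.
apply/norm_cvg0P; apply: (@squeeze_cvgr _ _ _ _ (cst 0) B) => //.
- by apply: nearW => y /=; rewrite normr_ge0 uB.
- exact: cvg_cst.
Qed.

Section taylor_expectation.
Context d (T : measurableType d) (R : realType) (P : probability T R).

(** Integrating the expansion at [x], the linear term vanishes with the mean. The main term depends
    on [Y] only through its variance, so laws with equal first two moments can be compared. *)
Lemma taylor2_expectation (Y : T -> R) (u : R -> R) (C K v M x a b : R) :
  measurable_fun setT Y -> P.-integrable setT (EFin \o (fun t => `|Y t| ^+ 3)) ->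
  \int[P]_t Y t = 0 -> \int[P]_t (Y t ^+ 2) = v ->
  \int[P]_t (`|Y t| ^+ 3) <= K ->
  measurable_fun setT u -> (forall y, `|u y| <= M) ->
  0 <= C -> taylor2 C u x a b ->
  `|\int[P]_t u (x + Y t) - (u x + b * (v / 2))| <= C * K.
Proof.
move=> mY iY3 Y1 Y2 Y3 mu uM C0 uT.
have iY : P.-integrable setT (EFin \o Y).
  exact: (integrable_expr (n := 1) mY _ iY3).
have iY2 : P.-integrable setT (EFin \o (fun t => Y t ^+ 2)).
  exact: (integrable_expr mY _ iY3).
have mxY : measurable_fun setT (fun t => x + Y t) by exact: measurable_funD.
have iu : P.-integrable setT (EFin \o (fun t => u (x + Y t))).
  by apply: (@bounded_integrable _ _ _ _ _ M) => //; exact: measurableT_comp.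
have iaY := integrable_scale a iY.
have ibY := integrable_scale (b / 2) iY2.
have iux := integrable_cst1 P (u x).
have iD1 := integrable_add iaY ibY.
have iD2 := integrable_add iux iD1.
have -> : \int[P]_t u (x + Y t) - (u x + b * (v / 2)) =
    \int[P]_t (u (x + Y t) - (u x + (a * Y t + b / 2 * Y t ^+ 2))).
  rewrite RintegralB// RintegralD// Rintegral_cst1 RintegralD//.
  rewrite RintegralZl// RintegralZl// Y1 Y2; ring.
have iB : P.-integrable setT
    (EFin \o (fun t => u (x + Y t) - (u x + (a * Y t + b / 2 * Y t ^+ 2)))).
  exact: (integrableB measurableT iu iD2).
rewrite (le_trans (le_normr_Rintegral _ iB))//.
apply: (@le_trans _ _ (\int[P]_t (C * `|Y t| ^+ 3))).
  apply: le_Rintegral => //.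
  - exact: (integrable_abse iB).
  - exact: integrable_scale.
  - move=> t _; rewrite (le_trans _ (uT (Y t)))// le_eqVlt; apply/orP; left.
    by apply/eqP; congr `|_|; ring.
by rewrite RintegralZl// ler_wpM2l.
Qed.

(** The expansions at the points [x + Y t] are integrated term by term; since the total mass is 1,
    the remainder constant does not grow. *)
Lemma average_taylor2 (Y : T -> R) (u u1 u2 : R -> R) (C M : R) :
  measurable_fun setT Y ->
  measurable_fun setT u -> measurable_fun setT u1 -> measurable_fun setT u2 ->
  (forall y, `|u y| <= M) -> (forall y, taylor2 C u y (u1 y) (u2 y)) ->
  forall x, taylor2 C (fun x => \int[P]_t u (x + Y t)) x
    (\int[P]_t u1 (x + Y t)) (\int[P]_t u2 (x + Y t)).
Proof.
move=> mY mu mu1 mu2 uM uT x h.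
(* Expansions at distance 1 bound the coefficients. *)
have bnd (y : R) : `|u1 y| <= M + C /\ `|u2 y| <= 4 * M + 2 * C.
  have := uT y 1; have := uT y (-1); have := uM (y + 1); have := uM (y - 1).
  have := uM y; rewrite normrN !normr1 !expr1n sqrrN expr1n !ler_norml.
  by move=> /andP[? ?] /andP[? ?] /andP[? ?] /andP[? ?] /andP[? ?]; split; lra.
have mxY z : measurable_fun setT (fun t => z + Y t) by exact: measurable_funD.
have iu z : P.-integrable setT (EFin \o (fun t => u (z + Y t))).
  by apply: (@bounded_integrable _ _ _ _ _ M) => //; exact: measurableT_comp.
have i1 : P.-integrable setT (EFin \o (fun t => u1 (x + Y t))).
  apply: (@bounded_integrable _ _ _ _ _ (M + C)).
    exact: measurableT_comp.
  by move=> t; have [] := bnd (x + Y t).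
have i2 : P.-integrable setT (EFin \o (fun t => u2 (x + Y t))).
  apply: (@bounded_integrable _ _ _ _ _ (4 * M + 2 * C)).
    exact: measurableT_comp.
  by move=> t; have [] := bnd (x + Y t).
have ih1 := integrable_scale h i1.
have ih2 := integrable_scale (h ^+ 2 / 2) i2.
have iD1 := integrable_add ih1 ih2.
have iD2 := integrable_add (iu x) iD1.
rewrite (_ : _ - _ = \int[P]_t (u (x + h + Y t) -
    (u (x + Y t) + (h * u1 (x + Y t) + h ^+ 2 / 2 * u2 (x + Y t))))); last first.
  rewrite RintegralB// RintegralD// RintegralD// RintegralZl// RintegralZl//; ring.
have iB : P.-integrable setT (EFin \o (fun t => u (x + h + Y t) -
    (u (x + Y t) + (h * u1 (x + Y t) + h ^+ 2 / 2 * u2 (x + Y t))))).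
  exact: (integrableB measurableT (iu _) iD2).
rewrite (le_trans (le_normr_Rintegral _ iB))//.
rewrite -[leRHS](Rintegral_cst1 P).
apply: le_Rintegral => //.
- exact: (integrable_abse iB).
- exact: integrable_cst1.
- move=> t _; rewrite (le_trans _ (uT (x + Y t) h))// le_eqVlt; apply/orP; left.
  by apply/eqP; congr `|_|; rewrite addrAC; ring.
Qed.

End taylor_expectation.

(** * Lindeberg's replacement method *)

Lemma measurable_integral_normal (R : realType) (t : R) (f : R -> \bar R) :
  0 < t -> measurable_fun [set: R] f -> (forall x, (0 <= f x)%E) ->
  measurable_fun [set: R] (fun y => \int[normal_prob y t]_w f w)%E.
Proof.
move=> t0 mf f0.
pose F (z : R * R) := (f z.2 * (normal_pdf z.1 t z.2)%:E)%E.
have mF : measurable_fun setT F.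
  apply: emeasurable_funM; first exact: measurableT_comp.
  by apply/measurable_EFinP; exact: measurable_normal_pdf2.
have F0 z : (0 <= F z)%E by rewrite mule_ge0// lee_fin normal_pdf_ge0.
under eq_fun do rewrite integral_normal_prob//.
exact: (@measurable_fun_fubini_tonelli_F _ _ _ _ R (@lebesgue_measure R) F mF F0).
Qed.

Section unit_valued.
Context d (T : measurableType d) (R : realType) (P : probability T R).

Lemma integral_unitE (f : T -> R) : measurable_fun setT f ->
  (forall x, 0 <= f x <= 1) ->
  (\int[P]_x (f x)%:E = (\int[P]_x f x)%:E)%E.
Proof.
move=> mf f01; rewrite /Rintegral fineK//; apply: integrable_fin_num => //.
apply: (@bounded_integrable _ _ _ _ _ 1) => // x.
by have /andP[f0 f1] := f01 x; rewrite ger0_norm.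
Qed.

Lemma Rintegral_unit (f : T -> R) : measurable_fun setT f ->
  (forall x, 0 <= f x <= 1) -> 0 <= \int[P]_x f x <= 1.
Proof.
move=> mf f01; rewrite Rintegral_ge0/=; last by move=> x _; have /andP[] := f01 x.
rewrite -[leRHS](Rintegral_cst1 P); apply: le_Rintegral => //.
- apply: (@bounded_integrable _ _ _ _ _ 1) => // x.
  by have /andP[f0 f1] := f01 x; rewrite ger0_norm.
- exact: integrable_cst1.
- by move=> x _; have /andP[] := f01 x.
Qed.

End unit_valued.

Section lindeberg.
Context d (T : measurableType d) (R : realType) (P : probability T R).
Variables (g : T -> R) (s B : R).
Hypotheses (mg : measurable_fun setT g) (s0 : 0 < s).
Hypotheses (g1 : \int[P]_t g t = 0) (g2 : \int[P]_t (g t ^+ 2) = s ^+ 2).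
Hypothesis gB : forall t, `|g t| <= B * s.

Let S n (t : n.-tuple T) := \sum_(i < n) g (tnth t i).

Let mS n : measurable_fun setT (@S n).
Proof.
apply: measurable_sum => i; apply: measurableT_comp => //.
exact: measurable_tnth.
Qed.

Definition tuple_average n (u : R -> R) x :=
  \int[tuple_power P n]_t u (x + \sum_(i < n) g (tnth t i)).

Lemma tuple_average0 (u : R -> R) x : measurable_fun setT u -> tuple_average 0 u x = u x.
Proof.
move=> mu; rewrite /tuple_average /Rintegral integral_dirac//=.
  by rewrite indicT mul1r big_ord0 addr0.
apply/measurable_EFinP; apply: measurableT_comp => //.
by apply: measurable_funD => //; exact: (@mS 0).
Qed.

(** The law of an [n.+1]-tuple is the image of a product under [tuple_cons], so Tonelli splits off
    the first entry. *)
Lemma tuple_averageS n (u : R -> R) x : measurable_fun setT u ->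
  (forall y, 0 <= u y <= 1) ->
  tuple_average n.+1 u x = \int[P]_y tuple_average n u (x + g y).
Proof.
move=> mu u01; rewrite /tuple_average.
have mun m (z : R) : measurable_fun setT (fun t : m.-tuple T => u (z + S t)).
  by apply: measurableT_comp => //; apply: measurable_funD => //; exact: mS.
pose F (z : T * n.-tuple T) := (u (x + g z.1 + S z.2))%:E.
have mF : measurable_fun setT F.
  apply/measurable_EFinP; apply: measurableT_comp => //.
  apply: measurable_funD; last exact: (measurableT_comp (@mS n) measurable_snd).
  by apply: measurable_funD => //; exact: measurableT_comp.
have F0 z : (0 <= F z)%E by rewrite lee_fin; have /andP[] := u01 (x + g z.1 + S z.2).
rewrite /Rintegral; congr fine => /=.
rewrite ge0_integral_distribution//; last 2 first.
- by apply/measurable_EFinP; exact: (mun n.+1).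
- by move=> y; rewrite lee_fin; have /andP[] := u01 (x + S y).
transitivity (\int[P \x tuple_power P n]_z F z)%E.
  apply: eq_integral => -[y t] _ /=; congr (u _)%:E.
  rewrite big_ord_recl tnth0 addrA; congr (_ + _).
  by apply: eq_bigr => i _; rewrite tnthS.
rewrite fubini_tonelli1//; apply: eq_integral => y _.
exact: (integral_unitE (tuple_power P n) (mun n (x + g y))
  (fun t => u01 (x + g y + S t))).
Qed.

(* [normal_prob x 0] is uniform on [0, 1] and not the Dirac mass at [x]. *)
Definition normal_average n (u : R -> R) x :=
  if n is 0%N then u x
  else \int[normal_prob x (Num.sqrt (n%:R * s ^+ 2))]_w u w.

(** Stability under convolution: the variances [s ^+ 2] and [n%:R * s ^+ 2] add up. For [n = 0] the
    single step is the whole law. *)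
Lemma normal_averageS n (u : R -> R) x : measurable_fun setT u ->
  (forall y, 0 <= u y <= 1) ->
  normal_average n.+1 u x = \int[normal_prob x s]_y normal_average n u y.
Proof.
move=> mu u01; case: n => [|n].
  by rewrite /normal_average mul1r sqrtr_sqr gtr0_norm.
rewrite /normal_average; set r := Num.sqrt (n.+1%:R * _).
have r0 : 0 < r by rewrite sqrtr_gt0 mulr_gt0// exprn_gt0.
have -> : Num.sqrt (n.+2%:R * s ^+ 2) = Num.sqrt (s ^+ 2 + r ^+ 2).
  have -> : r ^+ 2 = n.+1%:R * s ^+ 2 by rewrite sqr_sqrtr// mulr_ge0 ?sqr_ge0.
  by congr Num.sqrt; rewrite -(natr1 n.+1) mulrDl mul1r addrC.
have mEu : measurable_fun setT (fun w => (u w)%:E) by exact/measurable_EFinP.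
have Eu0 w : (0 <= (u w)%:E)%E by rewrite lee_fin; have /andP[] := u01 w.
rewrite [LHS]/Rintegral -(integral_normal_convolution x s0 r0 mEu Eu0).
congr fine; apply: eq_integral => y _.
exact: (integral_unitE (normal_prob y r) mu u01).
Qed.

Lemma measurable_normal_average n (u : R -> R) : measurable_fun setT u ->
  (forall y, 0 <= u y <= 1) -> measurable_fun setT (normal_average n u).
Proof.
move=> mu u01; case: n => [//|n]; rewrite /normal_average.
have r0 : 0 < Num.sqrt (n.+1%:R * s ^+ 2) by rewrite sqrtr_gt0 mulr_gt0// exprn_gt0.
apply/measurable_EFinP => /=.
rewrite (_ : _ \o _ = fun y =>
    \int[normal_prob y (Num.sqrt (n.+1%:R * s ^+ 2))]_w (u w)%:E)%E.
  apply: measurable_integral_normal => //; first exact/measurable_EFinP.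
  by move=> y; rewrite lee_fin; have /andP[] := u01 y.
by apply/funext => y /=; rewrite integral_unitE.
Qed.

Lemma normal_average_unit n (u : R -> R) : measurable_fun setT u ->
  (forall y, 0 <= u y <= 1) -> forall x, 0 <= normal_average n u x <= 1.
Proof. by move=> mu u01 x; case: n => [//|n]; exact: Rintegral_unit. Qed.

(** Induction on the number of entries. Replacing the first entry by a normal one changes the
    average of [v] by at most the two cubic remainders, because the first two moments agree; the
    other [n] entries are replaced by the induction hypothesis. The constant [C] is the same at
    every stage by [average_taylor2]. *)
Lemma lindeberg (u u1 u2 : R -> R) (C : R) : 0 <= C ->
  measurable_fun setT u -> measurable_fun setT u1 -> measurable_fun setT u2 ->
  (forall y, 0 <= u y <= 1) -> (forall y, taylor2 C u y (u1 y) (u2 y)) ->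
  forall n x, `|tuple_average n u x - normal_average n u x| <=
    n%:R * (C * ((B ^+ 3 + 31) * s ^+ 3)).
Proof.
move=> C0 mu mu1 mu2 u01 uT; elim => [|n IH] x.
  by rewrite tuple_average0// subrr normr0 mul0r.
have u1' y : `|u y| <= 1 by have /andP[? ?] := u01 y; rewrite ger0_norm.
pose v := tuple_average n u.
have v01 y : 0 <= v y <= 1.
  apply: Rintegral_unit => //; apply: measurableT_comp => //.
  by apply: measurable_funD => //; exact: mS.
have v1' y : `|v y| <= 1 by have /andP[? ?] := v01 y; rewrite ger0_norm.
have vT y : exists a b, taylor2 C v y a b.
  exists (\int[tuple_power P n]_t u1 (y + S t)).
  exists (\int[tuple_power P n]_t u2 (y + S t)).
  exact: (average_taylor2 (tuple_power P n) (@mS n) mu mu1 mu2 u1' uT).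
have mv : measurable_fun setT v.
  by apply: continuous_measurable_fun; exact: taylor2_continuous vT.
rewrite tuple_averageS// normal_averageS//.
have [a [b vTx]] := vT x.
have B0 : 0 <= B * s by exact: le_trans (gB point).
have ig3 : P.-integrable setT (EFin \o (fun t => `|g t| ^+ 3)).
  apply: (@bounded_integrable _ _ _ _ _ ((B * s) ^+ 3)).
    by apply: measurable_funX; exact: measurableT_comp.
  by move=> t; rewrite normrX normr_id lerXn2r// nnegrE.
have g3 : \int[P]_t (`|g t| ^+ 3) <= B ^+ 3 * s ^+ 3.
  rewrite -exprMn -[leRHS](Rintegral_cst1 P); apply: le_Rintegral => //.
    exact: integrable_cst1.
  by move=> t _; rewrite lerXn2r// nnegrE.
have hP : `|\int[P]_y v (x + g y) - (v x + b * (s ^+ 2 / 2))| <= C * (B ^+ 3 * s ^+ 3).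
  exact: (taylor2_expectation mg ig3 g1 g2 g3 mv v1' C0 vTx).
have hN : `|\int[normal_prob x s]_y v y - (v x + b * (s ^+ 2 / 2))| <= C * (31 * s ^+ 3).
  have := @taylor2_expectation _ _ _ (normal_prob x s) (fun y => y - x) v C
    (31 * s ^+ 3) (s ^+ 2) 1 x a b _ (integrable_normal_cube x s0) (normal_mean x s0)
    (normal_variance x s0) (normal_cube_le x s0) mv v1' C0 vTx.
  under eq_Rintegral do rewrite addrC subrK.
  by apply; exact: measurable_funB.
(* The induction hypothesis, averaged over the normal first step. *)
have hI : `|\int[normal_prob x s]_y v y - \int[normal_prob x s]_y normal_average n u y|
    <= n%:R * (C * ((B ^+ 3 + 31) * s ^+ 3)).
  have iv : (normal_prob x s).-integrable setT (EFin \o v).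
    exact: (@bounded_integrable _ _ _ (normal_prob x s) v 1).
  have iw : (normal_prob x s).-integrable setT (EFin \o normal_average n u).
    apply: (@bounded_integrable _ _ _ (normal_prob x s) _ 1).
      exact: measurable_normal_average.
    by move=> y; have /andP[? ?] := normal_average_unit n mu u01 y; rewrite ger0_norm.
  have iB := integrableB measurableT iv iw.
  rewrite -RintegralB// (le_trans (le_normr_Rintegral _ iB))//.
  rewrite -[leRHS](Rintegral_cst1 (normal_prob x s)).
  apply: le_Rintegral => //.
  - exact: (integrable_abse iB).
  - exact: (integrable_cst1 (normal_prob x s)).
have -> : n.+1%:R * (C * ((B ^+ 3 + 31) * s ^+ 3)) =
    n%:R * (C * ((B ^+ 3 + 31) * s ^+ 3)) +
    (C * (B ^+ 3 * s ^+ 3) + C * (31 * s ^+ 3)) :> R.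
  by rewrite -(natr1 n); ring.
(* Here [w] is the second order value shared by the averages [p] and [q] of [v] under the original
   and the normal step. *)
have dist4 (p q r w e e1 e2 : R) : `|p - w| <= e1 -> `|q - w| <= e2 ->
    `|q - r| <= e -> `|p - r| <= e + (e1 + e2).
  rewrite !ler_norml => /andP[? ?] /andP[? ?] /andP[? ?].
  by apply/andP; split; lra.
exact: dist4 hP hN hI.
Qed.

End lindeberg.

(** * A spline step function *)

Section spline.
Context {R : realType}.
Implicit Types x y h : R.

Definition pos_part x := Num.max x 0.

Lemma pos_part_cases x :
  (x <= 0 /\ pos_part x = 0) \/ (0 <= x /\ pos_part x = x).
Proof.
rewrite /pos_part; have [x0|/ltW x0] := leP x 0; [by left|by right].
Qed.

Lemma measurable_pos_part : measurable_fun setT pos_part.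
Proof. exact: measurable_maxr. Qed.

(** If [x] and [x + h] lie on the same side of 0, the remainder is 0 or h^3. Otherwise it is (x +
    h)^3 or h^3 - (x + h)^3, and [x + h] lies between 0 and [h]. *)
Lemma taylor2_pos_part_cube x :
  taylor2 1 (fun y => pos_part y ^+ 3) x (3 * pos_part x ^+ 2) (6 * pos_part x).
Proof.
move=> h; rewrite mul1r -normrX.
case: (pos_part_cases x) => -[x0 ->]; case: (pos_part_cases (x + h)) => -[y0 ->].
- by rewrite (_ : _ - _ = 0) ?normr0//; ring.
- rewrite (_ : _ - _ = (x + h) ^+ 3); last by ring.
  by rewrite !normrX lerXn2r ?nnegrE// !ger0_norm//; lra.
- rewrite (_ : _ - _ = (- (x + h)) ^+ 3 - (- h) ^+ 3); last by field.
  have z0 : 0 <= - (x + h) by lra.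
  have k0 : 0 <= - h by lra.
  have zk : (- (x + h)) ^+ 3 <= (- h) ^+ 3 by rewrite lerXn2r// ?nnegrE//; lra.
  have := exprn_ge0 3 z0; rewrite normrX -[`|h|]normrN (ger0_norm k0) ler_norml; lra.
- by rewrite (_ : _ - _ = h ^+ 3)//; field.
Qed.

(** A third backward difference of truncated powers. The pairs (3, 1/6), (2, 1/2) and (1, 1) for [k]
    and [c] give a smooth step and its first two derivatives. *)
Definition spline_diff (k : nat) (c : R) x := c * (pos_part x ^+ k -
  3 * pos_part (x - 1) ^+ k + 3 * pos_part (x - 2) ^+ k - pos_part (x - 3) ^+ k).

Lemma measurable_spline_diff k c : measurable_fun setT (spline_diff k c).
Proof.
have mp (z : R) : measurable_fun setT (fun x => pos_part (x - z) ^+ k).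
  apply: measurable_funX; apply: (measurableT_comp measurable_pos_part).
  exact: measurable_funB.
apply: measurable_funM => //; apply: measurable_funB => //.
apply: measurable_funD; last exact: measurable_funM.
apply: measurable_funB; last exact: measurable_funM.
by apply: measurable_funX; exact: measurable_pos_part.
Qed.

(* Third differences of [y ^ 3 / 6] are equal to 1: this is an integrated
   quadratic B-spline, going from 0 to 1 on [0, 3]. *)
Definition spline_step := spline_diff 3 6^-1.

(** The coefficients 1, 3, 3, 1 sum to 8, and 8/6 <= 2. *)
Lemma taylor2_spline x :
  taylor2 2 spline_step x (spline_diff 2 2^-1 x) (spline_diff 1 1 x).
Proof.
move=> h; have := taylor2_pos_part_cube (x - 3) h.
have := taylor2_pos_part_cube (x - 2) h; have := taylor2_pos_part_cube (x - 1) h.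
have := taylor2_pos_part_cube x h; rewrite /spline_step /spline_diff.
rewrite !mul1r !expr1 !(addrAC x _ h).
move: (pos_part (x + h) ^+ 3) (pos_part (x + h - 1) ^+ 3).
move: (pos_part (x + h - 2) ^+ 3) (pos_part (x + h - 3) ^+ 3).
move: (`|h| ^+ 3) (normr_ge0 (h ^+ 3)); rewrite normrX.
move=> H H0 p3 p2 p1 p0; rewrite !ler_norml.
move=> /andP[? ?] /andP[? ?] /andP[? ?] /andP[? ?]; apply/andP; split; lra.
Qed.

Lemma spline_step_le0 x : x <= 0 -> spline_step x = 0.
Proof.
move=> x0; rewrite /spline_step /spline_diff.
have p0 y : y <= 0 -> pos_part y = 0 by move=> y0; rewrite /pos_part; apply/max_idPr.
by rewrite !p0; [rewrite !expr0n/= !mulr0 !subr0 addr0 mulr0|lra..].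
Qed.

Lemma spline_step_ge3 x : 3 <= x -> spline_step x = 1.
Proof.
move=> x0; rewrite /spline_step /spline_diff.
have p0 y : 0 <= y -> pos_part y = y by move=> y0; rewrite /pos_part; apply/max_idPl.
by rewrite !p0; [field|lra..].
Qed.

Lemma spline_step_itv x : 0 <= spline_step x <= 1.
Proof.
rewrite /spline_step /spline_diff.
case: (pos_part_cases x) => -[x0 ->]; case: (pos_part_cases (x - 1)) => -[x1 ->];
case: (pos_part_cases (x - 2)) => -[x2 ->]; case: (pos_part_cases (x - 3)) => -[x3 ->];
  try (exfalso; lra).
(* Five consistent sign patterns are left, one for each interval cut out by 0, 1, 2 and 3, from left
   to right. *)
all: rewrite ?expr0n/= ?mulr0 ?subr0 ?addr0.
- by lra.
- have y0 : 0 <= 1 - x by lra.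
  have := exprn_ge0 3 x0; have := mulr_ge0 (mulr_ge0 x0 x0) y0.
  have := mulr_ge0 x0 y0; have := exprn_ge0 3 y0; nra.
- have y0 : 0 <= 2 - x by lra.
  have := mulr_ge0 (mulr_ge0 x1 x1) y0; have := mulr_ge0 x1 y0; nra.
- have y0 : 0 <= 3 - x by lra.
  have := exprn_ge0 3 y0; have := exprn_ge0 3 x2.
  have := mulr_ge0 (mulr_ge0 x2 x2) y0; have := mulr_ge0 x2 y0; nra.
- by rewrite (_ : 6^-1 * _ = 1); [lra|field].
Qed.

Lemma taylor2_scale (C t e : R) (u : R -> R) x a b : 0 < e ->
  taylor2 C u ((x - t) / e) a b ->
  taylor2 (C / e ^+ 3) (fun y => u ((y - t) / e)) x (a / e) (b / e ^+ 2).
Proof.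
move=> e0 uT h; have := uT (h / e).
rewrite (_ : (x + h - t) / e = (x - t) / e + h / e); last by rewrite -mulrDl addrAC.
rewrite normf_div (gtr0_norm e0) => H.
rewrite (_ : C / e ^+ 3 * _ = C * (`|h| / e) ^+ 3); last by field; rewrite gt_eqF.
rewrite (le_trans _ H)// le_eqVlt; apply/orP; left; apply/eqP; congr `|_|.
by field; rewrite gt_eqF.
Qed.

End spline.

(** * Gaussian tails *)

Section gaussian_tail.
Context {R : realType}.
Local Notation N := (normal_prob (0 : R) 1).
Implicit Types r s : R.

Lemma PhiE r : (Phi r)%:E = N `[r, +oo[%classic.
Proof.
rewrite /Phi /Rintegral.
have E : (\int[lebesgue_measure]_(t in `[r, +oo[)
    ((Num.sqrt (2 * pi))^-1 * expR (- (t ^+ 2 / 2)))%:E)%E = N `[r, +oo[%classic.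
  apply: eq_integral => t _; rewrite normal_pdfE ?oner_neq0//.
  rewrite /normal_peak /normal_fun subr0 expr1n mul1r.
  by rewrite -[pi *+ 2]mulr_natl mulNr.
by rewrite E fineK// fin_num_measure.
Qed.

Lemma Phi_split r s : r <= s -> ((Phi r)%:E = N `[r, s[%classic + (Phi s)%:E)%E.
Proof.
move=> rs; rewrite !PhiE -measureU//; last first.
  apply/seteqP; split=> // x [/=]; rewrite !in_itv/= andbT => /andP[_ xs] sx.
  by have := lt_le_trans xs sx; rewrite ltxx.
congr (N _); apply/seteqP; split => x /=; rewrite !in_itv/= !andbT.
  by move=> rx; have [xs|sx] := ltP x s; [left; rewrite rx|right].
by move=> [/andP[]//|]; exact: le_trans.
Qed.

(** The normal density never exceeds its peak. *)
Lemma Phi_lipschitz r s : r <= s -> `|Phi r - Phi s| <= normal_peak 1 * (s - r).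
Proof.
move=> rs; have E := Phi_split rs.
have Nf : N `[r, s[%classic \is a fin_num by exact: fin_num_measure.
have -> : Phi r - Phi s = fine (N `[r, s[%classic).
  by apply: EFin_inj; rewrite EFinB E -addeA subee// adde0 fineK.
rewrite ger0_norm ?fine_ge0// -lee_fin fineK//.
rewrite (@le_trans _ _ (\int[lebesgue_measure]_(x in `[r, s[)
    (cst (@normal_peak R 1)%:E x))%E)//.
  apply: ge0_le_integral => //.
  - by move=> x _; rewrite lee_fin normal_pdf_ge0.
  - apply/measurable_EFinP; apply: measurable_funTS; exact: measurable_normal_pdf.
  - by move=> x _; rewrite lee_fin normal_pdf_ub ?oner_neq0.
rewrite integral_cst//= lebesgue_measure_itv/= lte_fin; case: ifPn => _.
  by rewrite -EFinB -EFinM.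
by rewrite mule0 lee_fin mulr_ge0 ?normal_peak_ge0 ?subr_ge0.
Qed.

Lemma Phi_continuous : continuous (@Phi R).
Proof.
have pk : 0 < normal_peak 1 :> R by rewrite normal_peak_gt0// oner_neq0.
move=> r; apply/cvgrPdist_le => e e0; near=> s.
have h : `|Phi r - Phi s| <= normal_peak 1 * `|r - s|.
  have [rs|/ltW sr] := leP r s.
    by rewrite (ler0_norm (_ : r - s <= 0)) ?subr_le0// opprB Phi_lipschitz.
  by rewrite [leLHS]distrC (ger0_norm (_ : 0 <= r - s)) ?subr_ge0// Phi_lipschitz.
rewrite (le_trans h)// -ler_pdivlMl//; near: s.
have d0 : 0 < (normal_peak 1)^-1 * e by rewrite mulr_gt0// invr_gt0.
by apply/nbhs_ballP; exists ((normal_peak 1)^-1 * e) => //= x /ltW.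
Unshelve. all: by end_near. Qed.

Lemma Phi_decreasing r s : r < s -> Phi s < Phi r.
Proof.
move=> rs; rewrite -lte_fin (Phi_split (ltW rs)) -[ltLHS]add0e lteD2rE//.
(* Absolute values on [[r, s[] are at most [M], so [c] is a positive lower bound of the density
   there. *)
pose M := `|r| + `|s|; pose c := normal_peak 1 * expR (- (M ^+ 2 / 2)) : R.
have c0 : 0 < c by rewrite mulr_gt0 ?expR_gt0// normal_peak_gt0// oner_neq0.
apply: (@lt_le_trans _ _ (\int[lebesgue_measure]_(x in `[r, s[) (cst c%:E x))%E).
  by rewrite integral_cst//= lebesgue_measure_itv/= lte_fin rs lte_fin mulr_gt0// subr_gt0.
apply: ge0_le_integral => //.
- by move=> x _; rewrite lee_fin ltW.
- apply/measurable_EFinP; apply: measurable_funTS; exact: measurable_normal_pdf.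
- move=> x; rewrite /= in_itv/= => /andP[rx xs].
  rewrite lee_fin normal_pdfE ?oner_neq0// ler_pM2l ?normal_peak_gt0 ?oner_neq0//.
  rewrite /normal_fun ler_expR subr0 expr1n mulNr lerN2 ler_pM2r ?invr_gt0//.
  rewrite -[x ^+ 2]real_normK ?num_real// lerXn2r ?nnegrE ?addr_ge0//.
  rewrite ler_norml; apply/andP; split.
    by have := ler_norm (- r); have := normr_ge0 s; rewrite normrN /M; lra.
  by have := ler_norm s; have := normr_ge0 r; rewrite /M; lra.
Qed.

Lemma normal_chebyshev (A : set R) (b : R) : measurable A -> 0 < b ->
  (forall x, A x -> b ^+ 2 <= x ^+ 2) -> (N A <= (b ^- 2)%:E)%E.
Proof.
move=> mA b0 Ab; have b2 : 0 < b ^+ 2 by rewrite exprn_gt0.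
have iA := integrable_indicator N mA.
have i2 : N.-integrable setT (EFin \o (fun x : R => (x - 0) ^+ 2)).
  exact: integrable_normal_sqr.
have h : \int[N]_x (\1_A x : R) <= b ^- 2.
  have -> : b ^- 2 = \int[N]_x (b ^- 2 * (x - 0) ^+ 2).
    by rewrite RintegralZl// normal_variance// expr1n mulr1.
  apply: le_Rintegral => //; first exact: (@integrable_scale _ _ _ N).
  move=> x _; rewrite subr0 indicE; case: (boolP (x \in A)) => [|_] /=.
    by rewrite inE => /Ab; rewrite mulrC ler_pdivlMr// mul1r.
  by rewrite mulr_ge0// ?invr_ge0 ?sqr_ge0.
have AE := Rintegral_indicator N mA.
by rewrite -[N A]AE lee_fin.
Qed.

(** Chebyshev's inequality makes both tails beyond a suitable [b] smaller than [k] and [1 - k]; the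
    intermediate value theorem applies on [[-b, b]]. *)
Lemma Phi_surjective (k : R) : 0 < k < 1 -> exists r, Phi r = k.
Proof.
(* This [b] exceeds both 1 and [e^-1], whence b^2 > b > 1/e. *)
move=> /andP[k0 k1]; pose e := Num.min k (1 - k); pose b := 1 + e^-1.
have e0 : 0 < e by rewrite lt_min k0 subr_gt0.
have b1 : 1 < b by rewrite ltrDl invr_gt0.
have b0 : 0 < b by exact: lt_trans b1.
have be : b ^- 2 < e.
  rewrite -[ltRHS]invrK ltf_pV2 ?posrE ?invr_gt0 ?exprn_gt0//.
  rewrite (@lt_trans _ _ b)//; first by rewrite /b ltrDr.
  by rewrite expr2 ltr_pMr.
have [ek e1k] : e <= k /\ e <= 1 - k by rewrite !ge_min !lexx orbT.
have hb : Phi b <= k.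
  rewrite (le_trans _ ek)// (le_trans _ (ltW be))// -lee_fin PhiE.
  apply: normal_chebyshev => // x; rewrite /= in_itv/= andbT => bx.
  by rewrite lerXn2r// nnegrE ltW// (lt_le_trans b0).
have hNb : k <= Phi (- b).
  have : (N setT = N `]-oo, (- b)%R[%classic + (Phi (- b))%:E)%E.
    rewrite PhiE -measureU//; last first.
      apply/seteqP; split=> // x [/=]; rewrite !in_itv/= andbT => xs sx.
      by have := lt_le_trans xs sx; rewrite ltxx.
    congr (N _); apply/seteqP; split => x //= _; rewrite !in_itv/= andbT.
    by have [|] := ltP x (- b); [left|right].
  have c : (N `]-oo, (- b)%R[%classic <= (b ^- 2)%:E)%E.
    apply: normal_chebyshev => // x; rewrite /= in_itv/= => xb.
    by rewrite -(sqrrN x) lerXn2r ?nnegrE//; lra.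
  rewrite (_ : N setT = 1%E); last exact: (probability_setT N).
  have Nf : N `]-oo, (- b)%R[%classic \is a fin_num by exact: fin_num_measure.
  move: c; rewrite -(fineK Nf) lee_fin -EFinD => c h; have {}h := EFin_inj h.
  by move: c h be; move: (fine _) (Phi _) (b ^- 2) => p q w; lra.
have [|||c _ ck] := @IVT R (@Phi R) (- b) b k; last by exists c.
- by lra.
- by apply: continuous_subspaceT; exact: Phi_continuous.
- by rewrite ge_min hb orbT le_max hNb.
Qed.

Lemma Phi_invK (k : R) : 0 < k < 1 -> Phi (Phi_inv k) = k.
Proof.
move=> k01; rewrite /Phi_inv; have [r <-] := Phi_surjective k01.
by apply: pinvK; rewrite inE; exists r.
Qed.

End gaussian_tail.

(** * Tails of sums of bounded variables *)

Section central_limit.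
Context d (T : measurableType d) (R : realType) (P : probability T R).
Variables (g : T -> R) (B : R).
Hypotheses (mg : measurable_fun setT g) (gB : forall t, `|g t| <= B).
Hypotheses (g1 : \int[P]_t g t = 0) (g2 : \int[P]_t (g t ^+ 2) = 1).

Let ig : P.-integrable setT (EFin \o g).
Proof. exact: (bounded_integrable P mg gB). Qed.

Let ig2 : P.-integrable setT (EFin \o (fun t => g t ^+ 2)).
Proof.
apply: (@bounded_integrable _ _ _ P _ (B ^+ 2)); first exact: measurable_funX.
by move=> t; rewrite normrX lerXn2r// nnegrE// (le_trans _ (gB t)).
Qed.

(** The step [u] is 0 up to [t] and 1 from [r] on: its average bounds the tail at [t] from below for
    the normalised sum, and is at least [Phi r] for the normal law. Lindeberg's bound on the
    difference of the two averages is of order 1 / sqrt n. *)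
Lemma tuple_tail (t r k : R) : t < r -> k < Phi r ->
  \forall n \near \oo, (k%:E < tuple_power P n
    [set x : n.-tuple T | (t * Num.sqrt n%:R <= \sum_(i < n) g (tnth x i))%R])%E.
Proof.
(* The spline rises over [[0, 3]], so a third of the gap sends [t] to 0 and [r] to 3. *)
move=> tr kr; pose e := (r - t) / 3.
have e0 : 0 < e by rewrite divr_gt0// subr_gt0.
pose h x := (x - t) / e; pose u x := spline_step (h x).
pose u1 x := spline_diff 2 2^-1 (h x) / e.
pose u2 x := spline_diff 1 1 (h x) / e ^+ 2.
pose C := 2 / e ^+ 3.
have C0 : 0 <= C by rewrite divr_ge0// exprn_ge0// ltW.
have B0 : 0 <= B by exact: le_trans (gB point).
have mh : measurable_fun setT h by apply: measurable_funM => //; exact: measurable_funB.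
have mu : measurable_fun setT u.
  by apply: (measurableT_comp _ mh); exact: measurable_spline_diff.
have mu1 : measurable_fun setT u1.
  by apply: measurable_funM => //; apply: (measurableT_comp _ mh);
    exact: measurable_spline_diff.
have mu2 : measurable_fun setT u2.
  by apply: measurable_funM => //; apply: (measurableT_comp _ mh);
    exact: measurable_spline_diff.
have u01 y : 0 <= u y <= 1 by exact: spline_step_itv.
have uT y : taylor2 C u y (u1 y) (u2 y).
  by apply: taylor2_scale => //; exact: taylor2_spline.
pose K := C * (B ^+ 3 + 31).
have K0 : 0 <= K by rewrite mulr_ge0// addr_ge0// exprn_ge0.
have d0 : 0 < Phi r - k by rewrite subr_gt0.
near=> n.
have n0 : (0 < n)%N by near: n; exact: nbhs_infty_gt.
(* With this scale the [n] summands have total variance 1, and the error n K s^3 of [lindeberg]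
   reduces to K s. *)
pose s : R := (Num.sqrt n%:R)^-1.
have q0 : 0 < Num.sqrt n%:R :> R by rewrite sqrtr_gt0 ltr0n.
have s0 : 0 < s by rewrite invr_gt0.
have ns2 : n%:R * s ^+ 2 = 1 by rewrite exprVn sqr_sqrtr// divff// pnatr_eq0 -lt0n.
have Ks : K * s < Phi r - k.
  rewrite ltr_pdivrMr// -(ltr_pdivrMl _ _ d0).
  have Kd : 0 <= (Phi r - k)^-1 * K by rewrite mulr_ge0// invr_ge0 ltW.
  rewrite -(ltr_pXn2r (_ : 0 < 2)%N) ?nnegrE ?(ltW q0)//.
  by rewrite sqr_sqrtr//; near: n; exact: nbhs_infty_gtr.
pose gs y := g y * s.
have mgs : measurable_fun setT gs by exact: measurable_funM.
have gs1 : \int[P]_y gs y = 0 by rewrite RintegralZr// g1 mul0r.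
have gs2 : \int[P]_y (gs y ^+ 2) = s ^+ 2.
  under eq_Rintegral do rewrite /gs exprMn.
  by rewrite RintegralZr// g2 mul1r.
have gsB y : `|gs y| <= B * s by rewrite normrM (gtr0_norm s0) ler_pM2r.
have := lindeberg mgs s0 gs1 gs2 gsB C0 mu mu1 mu2 u01 uT n 0.
have -> : n%:R * (C * ((B ^+ 3 + 31) * s ^+ 3)) = K * s.
  by transitivity (n%:R * s ^+ 2 * (K * s)); [rewrite /K; ring|rewrite ns2 mul1r].
have hN : Phi r <= normal_average s n u 0.
  (* As [n] is positive, the normal branch of the definition applies, with variance 1. *)
  rewrite -(prednK n0) /normal_average (prednK n0) ns2 sqrtr1.
  rewrite -lee_fin PhiE -(Rintegral_indicator (normal_prob 0 1))// lee_fin.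
  apply: le_Rintegral => //.
  - exact: (integrable_indicator (normal_prob 0 1)).
  - apply: (@bounded_integrable _ _ _ (normal_prob 0 1) _ 1) => // y.
    by have /andP[? ?] := u01 y; rewrite ger0_norm.
  - move=> y _; rewrite indicE; case: (boolP (y \in _)) => [|_] /=;
      last by have /andP[] := u01 y.
    rewrite inE /= in_itv/= andbT => ry; rewrite /u spline_step_ge3// /h ler_pdivlMr// /e.
    by rewrite mulrC divfK//; lra.
pose A := [set x : n.-tuple T | t * Num.sqrt n%:R <= \sum_(i < n) g (tnth x i)].
rewrite -/A.
have mS : measurable_fun setT (fun x : n.-tuple T => \sum_(i < n) g (tnth x i)).
  apply: measurable_sum => i; apply: measurableT_comp => //.
  exact: measurable_tnth.
have mA : measurable A.
  have := mS measurableT _ (measurable_itv `[t * Num.sqrt n%:R, +oo[).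
  by congr measurable; apply/seteqP; split=> x /=; rewrite in_itv/= andbT; [case|split].
have hP : tuple_average P gs n u 0 <= fine (tuple_power P n A).
  have AE := Rintegral_indicator (tuple_power P n) mA.
  rewrite (le_trans _ (_ : \int[tuple_power P n]_y (\1_A y : R) <= _))//; last first.
    by rewrite le_eqVlt; apply/orP; left; apply/eqP; exact: (congr1 fine AE).
  apply: le_Rintegral => //.
  - apply: (@bounded_integrable _ _ _ (tuple_power P n) _ 1).
      apply: measurableT_comp => //; apply: measurable_funD => //.
      apply: measurable_sum => i; apply: measurableT_comp => //.
      exact: measurable_tnth.
    by move=> y; have /andP[? ?] := u01 (0 + \sum_(i < n) gs (tnth y i)); rewrite ger0_norm.
  - exact: (integrable_indicator (tuple_power P n)).
  - move=> y _; rewrite indicE; case: (boolP (y \in A)) => [_|yA] /=.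
      by have /andP[] := u01 (0 + \sum_(i < n) gs (tnth y i)).
    rewrite /u spline_step_le0// add0r /h pmulr_lle0 ?invr_gt0// subr_le0.
    rewrite -mulr_suml ler_pdivrMr//.
    by move: yA; rewrite notin_setE /A /= => /negP; rewrite -ltNge => /ltW.
rewrite -[tuple_power P n A]fineK ?fin_num_measure// lte_fin ler_norml => /andP[] .
by move: hP hN Ks; lra.
Unshelve. all: by end_near. Qed.

End central_limit.

(** * Observable diameter of l1 products *)

Lemma le_limn_einf (R : realType) (u : (\bar R)^nat) (c : \bar R) :
  (\forall n \near \oo, c <= u n)%E -> (c <= limn_einf u)%E.
Proof.
move=> [N _ Nu]; rewrite limn_einf_lim; apply: lime_ge.
  by apply: cvgP (@cvg_einfs_sup _ u).
exists N => // n /= Nn; apply: le_ereal_inf_tmp => _ [m /= nm <-].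
by apply: Nu => /=; exact: leq_trans nm.
Qed.

(** * Distance functions on metric spaces *)

Section distance_function.
Context (R : realType) (T : completeMetricType R).

(** Preimages of open left rays, which generate the Borel sets of the line, are open balls around
    [x]. *)
Lemma measurable_mdist (x : T) :
  measurable_fun [set: borelType T] (mdist x : borelType T -> R).
Proof.
apply: (measurability _ (RGenInftyO.measurableE R)) => _ [_ [c ->] <-].
rewrite setTI; apply: sub_sigma_algebra => /=.
rewrite (_ : _ @^-1` _ = ball x c); first exact: open_mball.
by rewrite ballEmdist; apply/seteqP; split=> y /=; rewrite in_itv/=.
Qed.

Lemma mdist_diam_le (x y : T) : ((mdist x y)%:E <= diam [set: T])%E.
Proof. by apply: ereal_sup_ubound; right; exists (x, y). Qed.

Lemma mdist_lipschitz (x y z : T) : `|mdist x y - mdist x z| <= mdist y z.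
Proof.
have := metric_triangle x y z; have := metric_triangle x z y.
by rewrite (metric_sym z y) ler_norml => ? ?; apply/andP; split; lra.
Qed.

Lemma l1_distance_lipschitz n (x : T) :
  lipschitz1 (fun y : l1_tuple T n => \sum_(i < n) mdist x (tnth y i) : R^o).
Proof.
move=> y z; rewrite -sumrB (le_trans (ler_norm_sum _ _ _))//.
by apply: ler_sum => i _; exact: mdist_lipschitz.
Qed.

End distance_function.

(** Connects the sigma-algebra generated by open sets, as in [partial_diam], with the default one on
    the reals. *)
Lemma borel_measurable_real (R : realType) (A : set R) :
  <<s @open R^o >> A -> measurable A.
Proof.
move: A; apply: smallest_sub; first exact: sigma_algebra_measurable.
by move=> A; exact: open_measurable.
Qed.

Lemma le_diam_real (R : realType) (A : set R^o) (x y : R^o) :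
  A x -> A y -> ((`|y - x|)%:E <= diam A)%E.
Proof. by move=> Ax Ay; apply: ereal_sup_ubound; right; exists (x, y). Qed.

(** Disjoint sets would have total mass above 1. *)
Lemma probability_meet d (T : measurableType d) (R : realType)
    (P : probability T R) (A B : set T) (k : R) :
  measurable A -> measurable B -> ((1 - k)%:E <= P A)%E -> (k%:E < P B)%E ->
  A `&` B !=set0.
Proof.
move=> mA mB PA PB; apply: contrapT => /set0P/negP/negPn/eqP AB.
have : (P A + P B <= 1)%E.
  by rewrite -measureU//; apply: probability_le1; exact: measurableU.
apply/negP; rewrite -ltNge.
have -> : (1 = (1 - k)%:E + k%:E :> \bar R)%E by rewrite -EFinD subrK.
by rewrite lee_ltD.
Qed.

Section product_space.
Context (R : realType) (X : mmspace R).
Local Notation P := (mm_prob X).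

(** The constant 0 is an admissible function, and [diam] is never negative. This settles the case
    where [Phi_inv kappa] is at most 0. *)
Lemma obs_diam_ge0 k : (0 <= obs_diam X k)%E.
Proof.
apply: (@le_trans _ _ (@partial_diam R R^o (@pushforward _ _ (borelType X)
  (borelType R^o) R P (cst 0)) (1 - k))).
  by apply: le_ereal_inf_tmp => _ [A _ <-]; apply: ereal_sup_ubound; left.
apply: ereal_sup_ubound; exists (cst 0) => // x y.
by rewrite subrr normr0 mdist_ge0.
Qed.

Variables (n : nat) (x0 : X).
Let f (y : n.-tuple (borelType X)) : R := \sum_(i < n) mdist x0 (tnth y i).

Let mf : measurable_fun setT f.
Proof.
apply: measurable_sum => i.
apply: (measurableT_comp (measurable_mdist x0)); exact: measurable_tnth.
Qed.

Lemma measurable_distance_sum (a : R) :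
  measurable [set y | a <= f y] /\ measurable [set y | f y <= a].
Proof.
split.
- have := mf measurableT (measurable_itv `[a, +oo[).
  by congr measurable; apply/seteqP; split=> x /=; rewrite in_itv/= andbT; [case|split].
- have := mf measurableT (measurable_itv `]-oo, a]).
  by congr measurable; apply/seteqP; split=> x /=; rewrite in_itv/=; [case|split].
Qed.

(** The preimage of any Borel set competing in the partial diameter of the distance sum meets both
    tails, so the set contains a value at least [a] and one at most [b]. *)
Lemma le_obs_diam (k a b : R) :
  (k%:E < tuple_power P n [set y | a <= f y]%R)%E ->
  (k%:E < tuple_power P n [set y | f y <= b]%R)%E ->
  ((a - b)%:E <= obs_diam (l1_product X n) k)%E.
Proof.
(* [F] is [f] read on the l1 space. As [l1_borel] is the identity, its push-forward measure unfolds
   to [tuple_power] of preimages under [f]. *)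
move=> Pa Pb; pose F (y : l1_product X n) : R^o := f y.
apply: (@le_trans _ _ (@partial_diam R R^o (@pushforward _ _
  (borelType (l1_product X n)) (borelType R^o) R (mm_prob (l1_product X n)) F)
  (1 - k))); last first.
  by apply: ereal_sup_ubound; exists F => //; exact: l1_distance_lipschitz.
apply: le_ereal_inf_tmp => _ [A [bA kA] <-].
have mA : measurable (f @^-1` A).
  by rewrite -[_ @^-1` _]setTI; apply: mf => //; exact: borel_measurable_real.
have [ma _] := measurable_distance_sum a; have [_ mb] := measurable_distance_sum b.
have [y [Ay ay]] := probability_meet mA ma kA Pa.
have [z [Az zb]] := probability_meet mA mb kA Pb.
rewrite (le_trans _ (le_diam_real Az Ay))// lee_fin.
by rewrite (le_trans _ (ler_norm _))// lerB.
Qed.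

End product_space.

(** * Variance of a distance function and the central limit bound *)

Section variance.
Context (R : realType) (X : mmspace R) (x0 : X).
Local Notation P := (mm_prob X).
Hypothesis finite_diam : (diam [set: X] < +oo)%E.
Local Notation f := (mdist x0 : borelType X -> R).

Let D := fine (diam [set: X]).

Let fD y : `|f y| <= D.
Proof.
have d0 : (0 <= diam [set: X])%E by apply: ereal_sup_ubound; left.
rewrite ger0_norm ?mdist_ge0// -lee_fin fineK ?mdist_diam_le//.
by rewrite ge0_fin_numE.
Qed.

Let m := \int[P]_y f y.
Let v := \int[P]_y ((f y - m) ^+ 2).

Let mf : measurable_fun setT f.
Proof. exact: measurable_mdist. Qed.

Let mfm : measurable_fun setT (fun y => f y - m).
Proof. exact: measurable_funB. Qed.

Let fmD y : `|f y - m| <= D + `|m|.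
Proof. by rewrite (le_trans (ler_normB _ _))// lerD2r. Qed.

Let iff_ : P.-integrable setT (EFin \o f).
Proof. exact: (bounded_integrable P mf fD). Qed.

Let ifm2 : P.-integrable setT (EFin \o (fun y => (f y - m) ^+ 2)).
Proof.
apply: (@bounded_integrable _ _ _ P _ ((D + `|m|) ^+ 2)).
  exact: measurable_funX.
by move=> y; rewrite normrX lerXn2r// nnegrE (le_trans _ (fmD y)).
Qed.

Let varE : 'V_P[mdist x0] = v%:E.
Proof.
rewrite /variance unlock unlock /= /v /Rintegral fineK; last exact: integrable_fin_num.
by apply: eq_integral => y _.
Qed.

Let v0 : 0 <= v.
Proof. by apply: Rintegral_ge0 => y _; exact: sqr_ge0. Qed.

(** Finite diameter makes the variance a real number; the form as a square lets bounds on the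
    standard deviation pass to it. *)
Lemma variance_mdist_fin : 'V_P[mdist x0] = (Num.sqrt (fine 'V_P[mdist x0]) ^+ 2)%:E.
Proof. by rewrite varE/= sqr_sqrtr. Qed.

(** The central limit bound is applied to the normalised distance and to its opposite, giving the
    two tails required by [le_obs_diam]. *)
Lemma near_obs_diam (k t : R) : 0 < k < 1 -> t < Phi_inv k ->
  0 < fine 'V_P[mdist x0] ->
  \forall n \near \oo,
    ((2 * t * Num.sqrt (fine 'V_P[mdist x0]))%:E <=
       obs_diam (l1_product X n) k * ((Num.sqrt n%:R)^-1)%:E)%E.
Proof.
rewrite varE /= => k01 tr v_gt0; set s := Num.sqrt v.
have s0 : 0 < s by rewrite sqrtr_gt0.
have sE : s ^+ 2 = v by rewrite sqr_sqrtr.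
(* The midpoint leaves room on both sides: [t < r] for the spline, and [k < Phi r] by strict
   monotonicity. *)
pose r := (t + Phi_inv k) / 2.
have [tr1 r1] : t < r /\ r < Phi_inv k by rewrite /r; split; lra.
have kr : k < Phi r by rewrite -[ltLHS](Phi_invK k01) Phi_decreasing.
pose g y := (f y - m) / s.
have mg : measurable_fun setT g by exact: measurable_funM.
have gB y : `|g y| <= (D + `|m|) / s.
  by rewrite normrM normfV (gtr0_norm s0) ler_pM2r ?invr_gt0.
have iffm : P.-integrable setT (EFin \o (fun y => f y - m)).
  exact: (bounded_integrable P mfm fmD).
have fm0 : \int[P]_y (f y - m) = 0.
  by rewrite RintegralB ?Rintegral_cst1 ?subrr//; exact: (integrable_cst1 P m).
have g1 : \int[P]_y g y = 0 by rewrite RintegralZr// fm0 mul0r.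
have g2 : \int[P]_y (g y ^+ 2) = 1.
  under eq_Rintegral do rewrite /g expr_div_n.
  by rewrite RintegralZr// sE -/v divff// gt_eqF.
pose h y := - g y.
have mh : measurable_fun setT h by exact: measurableT_comp.
have hB y : `|h y| <= (D + `|m|) / s by rewrite normrN.
have h1 : \int[P]_y h y = 0.
  under eq_Rintegral do rewrite /h -mulN1r.
  by rewrite RintegralZl ?g1 ?mulr0//; exact: (bounded_integrable P mg gB).
have h2 : \int[P]_y (h y ^+ 2) = 1 by under eq_Rintegral do rewrite /h sqrrN.
have U := tuple_tail mg gB g1 g2 tr1 kr.
have L := tuple_tail mh hB h1 h2 tr1 kr.
near=> n.
have n0 : (0 < n)%N by near: n; exact: nbhs_infty_gt.
have q0 : 0 < Num.sqrt n%:R :> R by rewrite sqrtr_gt0 ltr0n.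
have Un : (k%:E < tuple_power P n
  [set x : n.-tuple _ | (t * Num.sqrt n%:R <= \sum_(i < n) g (tnth x i))%R])%E by near: n.
have Ln : (k%:E < tuple_power P n
  [set x : n.-tuple _ | (t * Num.sqrt n%:R <= \sum_(i < n) h (tnth x i))%R])%E by near: n.
have sg (x : n.-tuple (borelType X)) :
    \sum_(i < n) g (tnth x i) = (\sum_(i < n) f (tnth x i) - n%:R * m) / s.
  by rewrite -mulr_suml sumrB sumr_const card_ord mulr_natl.
(* The thresholds of the two tails in terms of the sum before centring and scaling. *)
pose a := n%:R * m + t * Num.sqrt n%:R * s.
pose b := n%:R * m - t * Num.sqrt n%:R * s.
rewrite lee_pdivlMr// -EFinM.
rewrite (_ : 2 * t * s * _ = a - b); last by rewrite /a /b; ring.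
apply: (@le_obs_diam _ _ _ x0).
- move: Un; congr (_ < _)%E; congr (tuple_power P n _).
  apply/seteqP; split => x /=; rewrite sg ler_pdivlMr// /a; lra.
- move: Ln; congr (_ < _)%E; congr (tuple_power P n _).
  have sh (x : n.-tuple (borelType X)) :
      \sum_(i < n) h (tnth x i) = - \sum_(i < n) g (tnth x i) by rewrite sumrN.
  by apply/seteqP; split => x /=; rewrite sh sg -mulNr ler_pdivlMr// /b; lra.
Unshelve. all: by end_near. Qed.

End variance.

Theorem theorem1p3 (R : realType) (X : mmspace R) (kappa : R) :
  nontrivial X -> (diam [set: X] < +oo)%E -> 0 < kappa < 1 ->
  ((2 * Phi_inv kappa)%:E * (V1 X `^ 2^-1) <=
   limn_einf (fun n : nat =>
     obs_diam (l1_product X n) kappa * ((Num.sqrt n%:R)^-1)%:E))%E.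
Proof.
move=> _ fd k01; set r := Phi_inv kappa; set L := limn_einf _.
have L0 : (0 <= L)%E.
  apply: le_limn_einf; apply: nearW => n; apply: mule_ge0.
    exact: obs_diam_ge0.
  by rewrite lee_fin invr_ge0 sqrtr_ge0.
(* For [r <= 0] the left-hand side is nonpositive, even if it is infinite. *)
have [r0|r0] := leP r 0.
  by apply: le_trans L0; rewrite mule_le0_ge0 ?poweR_ge0// lee_fin; lra.
have key (x : X) : ((2 * r * Num.sqrt (fine 'V_(mm_prob X)[mdist x]))%:E <= L)%E.
  set V := fine _; have [V0|V0] := ltP 0 V; last first.
    by rewrite (ler0_sqrtr V0) mulr0.
  case EL : L L0 => [l| |] // L0; rewrite ?leey// lee_fin.
  have s0 : 0 < Num.sqrt V by rewrite sqrtr_gt0.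
  (* The choice [t = r - e / 2] loses exactly [e] in [2 * t]. *)
  rewrite -ler_pdivlMr//; apply/ler_addgt0Pr => e e0.
  have tr : r - e / 2 < r by rewrite ltrBlDr ltrDl divr_gt0.
  have := le_limn_einf (near_obs_diam fd k01 tr V0).
  rewrite -/L EL lee_fin -/V -ler_pdivlMr//; lra.
case EL : L L0 => [l| |] // L0; rewrite ?leey//.
have r2 : 0 < 2 * r by rewrite mulr_gt0.
have l0 : 0 <= l / (2 * r).
  by apply: divr_ge0; [rewrite -lee_fin|exact: ltW].
(* Since [2 * r] is positive, [key] bounds all standard deviations at once; squaring lets the bound
   pass to the supremum of the variances. *)
have VL : (V1 X <= ((l / (2 * r)) ^+ 2)%:E)%E.
  apply: ge_ereal_sup => _ [x _ <-].
  rewrite (variance_mdist_fin x fd) lee_fin lerXn2r ?nnegrE ?sqrtr_ge0//.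
  by rewrite ler_pdivlMr// mulrC -lee_fin -EL.
have V0 : (0 <= V1 X)%E.
  apply: (le_trans (variance_ge0 (mm_prob X) (mdist point))).
  by apply: ereal_sup_ubound; exists point.
rewrite poweR12_sqrt//.
have -> : l%:E = ((2 * r)%:E * (l / (2 * r))%:E)%E.
  by rewrite -EFinM mulrC divfK// gt_eqF.
rewrite lee_pmul2l ?lte_fin//.
have -> : (l / (2 * r))%:E = sqrte (((l / (2 * r)) ^+ 2)%:E) :> \bar R.
  by rewrite /sqrte sqrtr_sqr ger0_norm.
by rewrite lee_sqrt// lee_fin sqr_ge0.
Qed.
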